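(* Let $R\ge 1$, let $\hat{x}_0\in\mathbb{S}^2$ and $\delta>0$ be fixed, and let $K>1$. Let $f\in L^2(\mathbb{R}^3)$ with $\operatorname{supp} f\subset B_R$ and set $M_0=\|f\|_{L^2(\mathbb{R}^3)}$. Let $u\in H^2_{loc}(\mathbb{R}^3)$ be the unique radiating solution of $(\Delta+k^2)u=-f$ in $\mathbb{R}^3$, with far-field pattern $u^\infty(\hat{x},k)$, and assume $$\epsilon:=\|u^{\infty}\|_{L^{\infty}(\mathcal{V}_\delta(\hat{x}_0)\times (0,K))}<1.$$ Then there exist $\alpha\in(0,1)$ (depending only on $R$ and $\delta$) and a constant $C>0$ independent of $K$ such that $$\|f\|^2_{H^{-1}(\mathbb{R}^3)}\leq C\left[ K^3e^{2K(1-\alpha)}\epsilon^{2\alpha}+\frac{M_0^2}{K^{4/3}|\ln\epsilon|^{1/2}}\right].$$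
   Context: $B_R=\{x\in\mathbb{R}^3:|x|<R\}$. For $k>0$, $u$ denotes the unique solution of $(\Delta+k^2)u=-f$ in $\mathbb{R}^3$ satisfying the Sommerfeld radiation condition $\lim_{r=|x|\to\infty} r(\partial_r u-iku)=0$; its far-field pattern is $u^\infty(\hat{x},k)=\int_{\mathbb{R}^3}e^{-ik\hat{x}\cdot y}f(y)\,dy$, $\hat{x}\in\mathbb{S}^2$. $\mathcal{V}_\delta(\hat{x}_0)=\{\hat{x}\in\mathbb{S}^2:|\hat{x}-\hat{x}_0|<\delta\}$. The Fourier transform is $\hat f(\xi)=(2\pi)^{-3/2}\int_{\mathbb{R}^3}f(x)e^{-i\xi\cdot x}dx$ and $\|f\|^2_{H^{-1}(\mathbb{R}^3)}=\int_{\mathbb{R}^3}(1+|\xi|^2)^{-1}|\hat f(\xi)|^2d\xi$. *)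

(* Defs.v *)
From HB Require Import structures.
From mathcomp Require Import all_boot all_order all_algebra.
From mathcomp Require Import all_classical all_reals all_analysis.
Set Implicit Arguments. Unset Strict Implicit. Unset Printing Implicit Defensive.
Import Order.TTheory GRing.Theory Num.Theory.
Import numFieldNormedType.Exports.
Local Open Scope classical_set_scope.
Local Open Scope ring_scope.

Section R3.
Variable R : realType.
Definition pt3 := ((R * R) * R)%type.

Definition dot3 (x y : pt3) : R := x.1.1 * y.1.1 + x.1.2 * y.1.2 + x.2 * y.2.
Definition norm3 (x : pt3) : R := Num.sqrt (dot3 x x).
Definition sub3 (x y : pt3) : pt3 := ((x.1.1 - y.1.1, x.1.2 - y.1.2), x.2 - y.2).
Definition scale3 (k : R) (x : pt3) : pt3 := ((k * x.1.1, k * x.1.2), k * x.2).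

Definition leb3 := (((@lebesgue_measure R) \x (@lebesgue_measure R)) \x (@lebesgue_measure R))%E.

(* A complex-valued f is given by its real part fr and imaginary part fi.
   Real and imaginary parts of  \int e^{-i xi.y} f(y) dy. *)
Definition ftRe (fr fi : pt3 -> R) (xi : pt3) : R :=
  Rintegral leb3 setT (fun y => fr y * cos (dot3 xi y) + fi y * sin (dot3 xi y)).
Definition ftIm (fr fi : pt3 -> R) (xi : pt3) : R :=
  Rintegral leb3 setT (fun y => fi y * cos (dot3 xi y) - fr y * sin (dot3 xi y)).

(* |u^infty(xhat, k)| with u^infty(xhat,k) = \int e^{-i k xhat.y} f(y) dy *)
Definition farfield_abs (fr fi : pt3 -> R) (xhat : pt3) (k : R) : R :=
  Num.sqrt (ftRe fr fi (scale3 k xhat) ^+ 2 + ftIm fr fi (scale3 k xhat) ^+ 2).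

(* |\hat f(xi)|^2 with \hat f(xi) = (2 pi)^{-3/2} \int f(x) e^{-i xi.x} dx *)
Definition fhat_abs2 (fr fi : pt3 -> R) (xi : pt3) : R :=
  (2 * pi) ^- 3 * (ftRe fr fi xi ^+ 2 + ftIm fr fi xi ^+ 2).

Definition Hm1_norm2 (fr fi : pt3 -> R) : \bar R :=
  (\int[leb3]_xi ((1 + dot3 xi xi)^-1 * fhat_abs2 fr fi xi)%:E)%E.

Definition L2_norm2 (fr fi : pt3 -> R) : \bar R :=
  (\int[leb3]_y ((fr y) ^+ 2 + (fi y) ^+ 2)%:E)%E.

Definition cap_times_interval (x0 : pt3) (delta K : R) : set (pt3 * R) :=
  [set p | norm3 p.1 = 1 /\ norm3 (sub3 p.1 x0) < delta /\ 0 < p.2 < K].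

(* ||u^infty||_{L^infty(V_delta(x0) x (0,K))}; u^infty is continuous, so the
   essential supremum over this relatively open set equals the supremum. *)
Definition farfield_sup (fr fi : pt3 -> R) (x0 : pt3) (delta K : R) : R :=
  sup [set farfield_abs fr fi p.1 p.2 | p in cap_times_interval x0 delta K].
End R3.

(* Main.v *)
Require Import Defs.
From HB Require Import structures.
From mathcomp Require Import all_boot all_order all_algebra.
From mathcomp Require Import all_classical all_reals all_analysis.
From mathcomp Require Import measurable_realfun.
From mathcomp Require Import ring lra zify.
Set Implicit Arguments. Unset Strict Implicit. Unset Printing Implicit Defensive.
Import Order.TTheory GRing.Theory Num.Theory.
Import numFieldNormedType.Exports.
Local Open Scope classical_set_scope.
Local Open Scope ring_scope.

(** Take [alpha = 1/2], write [L = |ln eps|] and cut frequencies at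
    [rho = K^(2/3) L^(1/4)].

    High frequencies. For [|xi| > rho] the weight [(1 + |xi|^2)^-1] is at most
    [rho^-2], and the Fourier transform is bounded on [L^2]. The latter follows
    from Schur's test for the kernel of the product weight
    [w_N(t) = max(0, 1 - t^2/N^2)], whose cosine transform is dominated by the
    Cauchy kernel [16 N / (4 + N^2 s^2)] of integral [8 pi], after letting [N]
    tend to infinity.

    Low frequencies. For [|xi| <= rho] the transform is extrapolated along the
    segment from a point [s x0] of the observation cone to [xi]. In Newton's
    forward formula with [m] equidistant nodes, of which the first [n] lie in the
    cone, the differences of order at most [n] are bounded by the data [eps], and
    those of higher order by [(X/m)^k] since the [k]-th difference of
    [j |-> cos (c + j b)] is at most [|b|^k]. Taking [n] proportional to [rho]
    gives [|F(xi)| <= eps exp(c n (1 + rho/K)) + c M0 exp(-8 rho)]; with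
    [a = K^(1/3)] and [b = L^(1/4)] the exponent is a combination of [a^2 b],
    [a b^2] and [b], hence at most [(a^3 + b^4)/2 + c = (K + L)/2 + c].

    If [eps = 0], letting [n] tend to infinity shows that the transform vanishes
    identically; the right-hand side is then nonnegative whatever the junk value
    of the quotient. *)

(** * Finite differences and extrapolation by Newton's forward formula *)

Section finite_differences.
Variable R : realType.
Implicit Types g u v : nat -> R.

Definition fdiff g : nat -> R := fun j => g j.+1 - g j.

(** The shift is the identity plus [fdiff], so this is the binomial theorem for its [m]-th power.
    The induction applies the hypothesis to [g] and to [fdiff g] and closes with Pascal's rule. *)
Lemma newton_forward m : forall g j,
  g (j + m)%N = \sum_(k < m.+1) 'C(m, k)%:R * iter k fdiff g j.
Proof.
elim: m => [|m IH] g j.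
  by rewrite big_ord_recl big_ord0 /= bin0 mul1r addr0 addn0.
have -> : g (j + m.+1)%N = g (j + m)%N + fdiff g (j + m)%N.
  by rewrite /fdiff addnS addrC subrK.
rewrite (IH g) (IH (fdiff g)).
have -> : \sum_(k < m.+2) 'C(m.+1, k)%:R * iter k fdiff g j =
  g j + \sum_(k < m.+1) ('C(m, k.+1) + 'C(m, k))%:R * iter k.+1 fdiff g j.
  by rewrite big_ord_recl /= bin0 mul1r; congr +%R; apply: eq_bigr => k _;
    rewrite /bump /= add1n binS.
rewrite [X in X + _]big_ord_recl /= bin0 mul1r -addrA; congr +%R.
under [X in _ = X]eq_bigr => k _ do rewrite natrD mulrDl.
rewrite big_split /= [X in _ = X + _]big_ord_recr /= bin_small // mul0r addr0.
by congr +%R; apply: eq_bigr => k _; rewrite -iterS iterSr.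
Qed.

Lemma iter_fdiff_le k : forall g j (e : R),
  (forall i, (j <= i <= j + k)%N -> `|g i| <= e) -> `|iter k fdiff g j| <= 2 ^+ k * e.
Proof.
elim: k => [|k IH] g j e h /=; first by rewrite mul1r; apply: h; lia.
rewrite /fdiff (le_trans (ler_normB _ _))// exprS -mulrA mulr_natl mulr2n lerD//.
  by apply: IH => i hi; apply: h; lia.
by apply: IH => i hi; apply: h; lia.
Qed.

Lemma iter_fdiff_lin k (a b : R) u v : forall j,
  iter k fdiff (fun j => a * u j + b * v j) j = a * iter k fdiff u j + b * iter k fdiff v j.
Proof. by elim: k => [//|k IH] j /=; rewrite /fdiff !IH; ring. Qed.

(** One difference with step [b] multiplies by [2 * sin (b / 2)] and advances the phase by
    [b / 2 + pi / 2], so the result is again a cosine and the step can be iterated. *)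
Lemma iter_fdiff_cos k (a b : R) j :
  iter k fdiff (fun j => cos (a + j%:R * b)) j =
  (2 * sin (b / 2)) ^+ k * cos (a + k%:R * (b / 2 + pi / 2) + j%:R * b).
Proof.
elim: k j => [|k IH] j /=; first by rewrite mul1r mul0r addr0.
rewrite /fdiff !IH -mulrBr [in RHS]exprS [2 * _ * _]mulrC -[in RHS]mulrA; congr (_ * _).
set c := a + _.
have -> : c + j.+1%:R * b = (c + j%:R * b + b / 2) + b / 2 by rewrite -natr1; field.
have -> : a + k.+1%:R * (b / 2 + pi / 2) + j%:R * b = (c + j%:R * b + b / 2) + pi / 2.
  by rewrite /c -natr1; ring.
have e : c + j%:R * b = (c + j%:R * b + b / 2) - b / 2 by field.
rewrite {2}e cosDpihalf cosD cosB; ring.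
Qed.

Lemma normr_sin_le (x : R) : `|sin x| <= `|x|.
Proof.
wlog x0 : x / 0 < x => [hw|].
  have [/hw//|h|<-] := ltgtP 0 x; last by rewrite sin0.
  by rewrite -normrN -sinN -[in leRHS]normrN; apply: hw; rewrite oppr_gt0.
have [c _] := @MVT R sin cos 0 x x0 (fun z _ => is_derive_sin z)
  (continuous_subspaceT (@continuous_sin R)).
rewrite sin0 !subr0 => ->; rewrite normrM ler_piMl//; exact: cos_max.
Qed.

Lemma iter_fdiff_cos_le k (a b : R) j :
  `|iter k fdiff (fun j => cos (a + j%:R * b)) j| <= `|b| ^+ k.
Proof.
rewrite iter_fdiff_cos normrM normrX.
apply: (@le_trans _ _ (`|2 * sin (b / 2)| ^+ k)).
  by rewrite ler_piMr ?exprn_ge0 ?cos_max.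
apply: lerXn2r; rewrite ?nnegrE// normrM ger0_norm//.
apply: (le_trans (ler_wpM2l _ (normr_sin_le _))) => //.
by rewrite normrM normfV [`|2|]ger0_norm// mulrCA divff// mulr1.
Qed.

Lemma iter_fdiff_sin_le k (a b : R) j :
  `|iter k fdiff (fun j => sin (a + j%:R * b)) j| <= `|b| ^+ k.
Proof.
have -> : (fun j : nat => sin (a + j%:R * b)) = (fun j : nat => cos (a - pi / 2 + j%:R * b)).
  by apply/funext => i; rewrite addrAC cosBpihalf.
exact: iter_fdiff_cos_le.
Qed.

Lemma expr_1Dx_div_le (m : nat) (x : R) : 0 <= x -> (1 + x / m%:R) ^+ m <= expR x.
Proof.
case: m => [|m] x0; first by rewrite expr0 -expR0 ler_expR.
have -> : expR x = expR (x / m.+1%:R) ^+ m.+1.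
  by rewrite -expRM_natr -mulrA mulVf ?mulr1// pnatr_eq0.
apply: lerXn2r; rewrite ?nnegrE ?expR_ge0 ?expR_ge1Dx//.
by rewrite addr_ge0// divr_ge0.
Qed.

(** The sum is the binomial expansion of [(1 + x / m) ^ m]. *)
Lemma sum_bin_exp_le (m : nat) (x : R) : 0 <= x ->
  \sum_(k < m.+1) 'C(m, k)%:R * (x / m%:R) ^+ k <= expR x.
Proof.
move=> x0; apply: le_trans (expr_1Dx_div_le m x0).
rewrite exprDn ler_sum// => k _.
by rewrite expr1n mul1r mulr_natl.
Qed.

(* The low-order differences are controlled by the data (through [eps]), the
   high-order ones by analyticity (through [X]). *)
Lemma newton_extrapolation g (n m : nat) (eps M X : R) :
  (0 < n <= m)%N -> 0 <= eps -> 0 <= M -> 0 <= X ->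
  (forall j, (j <= n)%N -> `|g j| <= eps) ->
  (forall k, `|iter k fdiff g 0| <= M * (X / m%:R) ^+ k) ->
  `|g m| <= eps * ((m%:R / n%:R) ^+ n * expR (2 * n%:R)) + M * expR (4 * X - n%:R).
Proof.
move=> /andP[n0 nm] e0 M0 X0 hg hX.
have m0 : (0 < m)%N by lia.
have n0' : 0 < n%:R :> R by rewrite ltr0n.
have m0' : 0 < m%:R :> R by rewrite ltr0n.
have mn1 : 1 <= m%:R / n%:R :> R by rewrite ler_pdivlMr// mul1r ler_nat.
(* This bound pays for the factor [expR (- n)] in the second term: once [k] exceeds [n], [4 ^ k]
   outweighs [expR n]. *)
have e3 : expR 1 <= 4 :> R.
  have -> : expR 1 = (expR (- 2^-1))^-1 ^+ 2 :> R.
    by rewrite -expRN -expRM_natr; congr expR; field.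
  have h : 2^-1 <= expR (- 2^-1) :> R by apply: le_trans (expR_ge1Dx _); lra.
  have -> : 4 = 2 ^+ 2 :> R by ring.
  apply: lerXn2r; rewrite ?nnegrE ?invr_ge0 ?expR_ge0//.
  by rewrite -[leRHS]invrK lef_pV2 ?posrE ?expR_gt0 ?invr_gt0.
rewrite -[m in g m]add0n newton_forward.
apply: (le_trans (ler_norm_sum _ _ _)).
(* Every term is majorised by a sum of two nonnegative terms, one adequate for [k <= n] and the
   other for [k > n]. Both sums then run over the full range and become exponentials. *)
apply: (@le_trans _ _ (\sum_(k < m.+1)
   (eps * (m%:R / n%:R) ^+ n * ('C(m, k)%:R * ((2 * n%:R) / m%:R) ^+ k) +
    M * expR (- n%:R) * ('C(m, k)%:R * (4 * X / m%:R) ^+ k)))); last first.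
  rewrite big_split /= -!mulr_sumr; apply: lerD.
    rewrite mulrA; apply: ler_wpM2l; first by rewrite mulr_ge0// exprn_ge0// divr_ge0.
    by apply: sum_bin_exp_le; rewrite mulr_ge0.
  rewrite [4 * X - _]addrC expRD mulrA.
  apply: ler_wpM2l; first by rewrite mulr_ge0// expR_ge0.
  by apply: sum_bin_exp_le; rewrite mulr_ge0.
apply: ler_sum => k _.
rewrite normrM normr_nat.
have c0 : 0 <= 'C(m, k)%:R :> R by [].
have t1 : 0 <= eps * (m%:R / n%:R) ^+ n * ('C(m, k)%:R * (2 * n%:R / m%:R) ^+ k).
  by rewrite !mulr_ge0// ?exprn_ge0// ?divr_ge0// mulr_ge0.
have t2 : 0 <= M * expR (- n%:R) * ('C(m, k)%:R * (4 * X / m%:R) ^+ k).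
  by rewrite !mulr_ge0// ?expR_ge0// ?exprn_ge0// divr_ge0// mulr_ge0.
have [kn|kn] := leqP k n.
  apply: ler_wpDr => //.
  rewrite mulrCA; apply: ler_wpM2l => //.
  apply: (@le_trans _ _ (2 ^+ k * eps)).
    by apply: iter_fdiff_le => i /andP[_ hi]; apply: hg; rewrite (leq_trans hi)// add0n.
  rewrite -[eps * _ * _]mulrA [leLHS]mulrC; apply: ler_wpM2l => //.
  rewrite -[2 * _ / _]mulrA [(2 * _) ^+ _]exprMn mulrCA ler_peMr ?exprn_ge0//.
  (* The last [k] factors cancel [(n / m) ^ k]; the remaining ones are at least 1 because
     [n <= m]. *)
  have -> : (m%:R / n%:R) ^+ n = (m%:R / n%:R) ^+ (n - k) * (m%:R / n%:R) ^+ k :> R.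
    by rewrite -exprD subnK.
  rewrite -[n%:R / m%:R]invf_div exprVn mulfK; first exact: exprn_ege1.
  by rewrite expf_neq0// gt_eqF// divr_gt0.
apply: ler_wpDl => //.
rewrite mulrCA; apply: ler_wpM2l => //.
apply: (le_trans (hX k)); rewrite -!mulrA; apply: ler_wpM2l => //.
rewrite [(4 * _) ^+ _]exprMn mulrA ler_peMl ?exprn_ge0 ?divr_ge0//.
rewrite expRN mulrC ler_pdivlMr ?expR_gt0// mul1r.
apply: (@le_trans _ _ (4 ^+ n)); last by rewrite ler_eXn2l ?ltr1n// ltnW.
rewrite -[n%:R]mul1r expRM_natr; apply: lerXn2r; rewrite ?nnegrE ?expR_ge0//.
Qed.
End finite_differences.

(** * Tonelli and Fubini for tensor products, and integrals with a parameter *)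

Section fubini.
Context d1 d2 (T1 : measurableType d1) (T2 : measurableType d2) (R : realType).
Variable m1 : {sigma_finite_measure set T1 -> \bar R}.
Variable m2 : {sigma_finite_measure set T2 -> \bar R}.

Lemma EFin_Rintegral d (T : measurableType d) (m : {measure set T -> \bar R}) (g : T -> R) :
  m.-integrable setT (EFin \o g) ->
  (Rintegral m setT g)%:E = (\int[m]_x (g x)%:E)%E.
Proof. by move=> ig; rewrite /Rintegral fineK//; exact: integrable_fin_num. Qed.

Lemma integrable_mul_bounded d (T : measurableType d) (m : {measure set T -> \bar R})
    (f g : T -> R) (M : R) :
  m.-integrable setT (EFin \o f) -> measurable_fun setT g -> (forall x, `|g x| <= M) ->
  m.-integrable setT (fun x => (f x * g x)%:E).
Proof.
move=> intf mg gM; have mf : measurable_fun setT f by apply/measurable_EFinP/(measurable_int m).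
apply: (@le_integrable _ _ _ m setT measurableT _ (fun x => (M%:E * (f x)%:E)%E)).
- by apply/measurable_EFinP; exact: measurable_funM.
- move=> x _ /=; rewrite lee_fin !normrM mulrC; apply: ler_wpM2r => //.
  by rewrite (le_trans (gM x))// ler_norm.
- exact: integrableZl.
Qed.

Lemma ge0_integral_tensor (a : T1 -> R) (b : T2 -> R) :
  measurable_fun setT a -> measurable_fun setT b ->
  (forall x, 0 <= a x) -> (forall y, 0 <= b y) ->
  (\int[m1 \x m2]_z (a z.1 * b z.2)%:E =
   \int[m1]_x (a x)%:E * \int[m2]_y (b y)%:E)%E.
Proof.
move=> ma mb a0 b0.
rewrite (fubini_tonelli1 (fun z : T1 * T2 => (a z.1 * b z.2)%:E)); last 2 first.
- apply/measurable_EFinP; apply: measurable_funM.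
    exact: (measurableT_comp ma measurable_fst).
  exact: (measurableT_comp mb measurable_snd).
- by move=> z; rewrite lee_fin mulr_ge0.
rewrite /fubini_F /=.
under eq_integral => x _.
  under eq_integral => y _ do rewrite EFinM.
  rewrite ge0_integralZl//; last 3 first.
  - exact/measurable_EFinP.
  - by move=> y _; rewrite lee_fin.
  - by rewrite lee_fin.
  over.
rewrite ge0_integralZr//.
- exact/measurable_EFinP.
- by move=> x _; rewrite lee_fin.
- by apply: integral_ge0 => y _; rewrite lee_fin.
Qed.

Lemma integrable_tensor (a : T1 -> R) (b : T2 -> R) :
  m1.-integrable setT (EFin \o a) -> m2.-integrable setT (EFin \o b) ->
  (m1 \x m2)%E.-integrable setT (fun z => (a z.1 * b z.2)%:E).
Proof.
move=> ia ib.
have ma : measurable_fun setT a by apply/measurable_EFinP/(measurable_int m1).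
have mb : measurable_fun setT b by apply/measurable_EFinP/(measurable_int m2).
apply/integrableP; split.
  apply/measurable_EFinP; apply: measurable_funM.
    exact: (measurableT_comp ma measurable_fst).
  exact: (measurableT_comp mb measurable_snd).
under eq_integral => z _ do rewrite /= normrM.
rewrite (@ge0_integral_tensor (fun x => `|a x|) (fun y => `|b y|))//.
- case/integrableP : ia => _ ia; case/integrableP : ib => _ ib.
  by apply: lte_mul_pinfty => //; [exact: integral_ge0|rewrite ge0_fin_numE; [|exact: integral_ge0]].
- exact: measurableT_comp.
- exact: measurableT_comp.
Qed.

Lemma integrable_tensor_bounded (a : T1 -> R) (b : T2 -> R) (h : T1 * T2 -> R) (M : R) :
  m1.-integrable setT (EFin \o a) -> m2.-integrable setT (EFin \o b) ->
  measurable_fun setT h -> (forall z, `|h z| <= M) ->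
  (m1 \x m2)%E.-integrable setT (fun z => (a z.1 * b z.2 * h z)%:E).
Proof.
by move=> ia ib mh hM; apply: (integrable_mul_bounded _ mh hM); exact: integrable_tensor.
Qed.

(** Fubini's theorem applies because the tensor product of [a] and [b] is integrable and [h] is
    bounded. *)
Lemma Rintegral_exchange (a : T1 -> R) (b : T2 -> R) (h : T1 * T2 -> R) (M : R) :
  m1.-integrable setT (EFin \o a) -> m2.-integrable setT (EFin \o b) ->
  measurable_fun setT h -> (forall z, `|h z| <= M) ->
  Rintegral m1 setT (fun x => a x * Rintegral m2 setT (fun y => b y * h (x, y))) =
  Rintegral m2 setT (fun y => b y * Rintegral m1 setT (fun x => a x * h (x, y))).
Proof.
move=> ia ib mh hM.
have mh1 x : measurable_fun setT (fun y => h (x, y)) by exact: measurableT_comp.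
have mh2 y : measurable_fun setT (fun x => h (x, y)) by exact: measurableT_comp.
rewrite /Rintegral; congr fine.
have := Fubini (integrable_tensor_bounded ia ib mh hM) => /= F.
transitivity (\int[m1]_x \int[m2]_y (a x * b y * h (x, y))%:E)%E.
  apply: eq_integral => x _; rewrite -/(Rintegral _ _ _) EFinM EFin_Rintegral.
    rewrite -integralZl//; last exact: (integrable_mul_bounded ib (mh1 x)).
    by apply: eq_integral => y _; rewrite -EFinM mulrA.
  exact: (integrable_mul_bounded ib (mh1 x)).
rewrite F; apply: eq_integral => y _; rewrite -/(Rintegral _ _ _) EFinM EFin_Rintegral.
  rewrite -integralZl//; last exact: (integrable_mul_bounded ia (mh2 y)).
  by apply: eq_integral => x _; rewrite -EFinM mulrCA mulrA.
exact: (integrable_mul_bounded ia (mh2 y)).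
Qed.

(** The integrals of the positive and the negative part are measurable in the parameter by Tonelli,
    and [Rintegral] is [fine] of their difference. *)
Lemma measurable_Rintegral_param (b : T2 -> R) (h : T1 * T2 -> R) :
  measurable_fun setT b -> measurable_fun setT h ->
  measurable_fun setT (fun x => Rintegral m2 setT (fun y => b y * h (x, y))).
Proof.
move=> mb mh.
have mg : measurable_fun setT (fun z : T1 * T2 => (b z.2 * h z)%:E).
  apply/measurable_EFinP; apply: measurable_funM => //.
  exact: (measurableT_comp mb measurable_snd).
apply: measurableT_comp => //=.
under eq_fun do rewrite integralE.
apply: emeasurable_funB.
  under eq_fun => x.
    under eq_integral => y _ do rewrite (funepos_comp (fun z => (b z.2 * h z)%:E) (fun y => (x, y))).
    over.
  by apply: measurable_fun_fubini_tonelli_F => //; exact: measurable_funepos.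
under eq_fun => x.
  under eq_integral => y _ do rewrite (funeneg_comp (fun z => (b z.2 * h z)%:E) (fun y => (x, y))).
  over.
by apply: measurable_fun_fubini_tonelli_F => //; exact: measurable_funeneg.
Qed.

(** The free phase makes the property stable under products: the inner integral, with phase
    [u x + phi], returns a multiple of [cos (u x + phi)], to which the hypothesis on [a] applies.
    The conclusion has the same form, so the lemma can be iterated. *)
Lemma Rintegral_tensor_cos (a : T1 -> R) (b : T2 -> R) (u : T1 -> R) (v : T2 -> R) (p q : R) :
  m1.-integrable setT (EFin \o a) -> m2.-integrable setT (EFin \o b) ->
  measurable_fun setT u -> measurable_fun setT v ->
  (forall phi, Rintegral m1 setT (fun x => a x * cos (u x + phi)) = p * cos phi) ->
  (forall phi, Rintegral m2 setT (fun y => b y * cos (v y + phi)) = q * cos phi) ->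
  forall phi, Rintegral (m1 \x m2)%E setT (fun z => a z.1 * b z.2 * cos (u z.1 + v z.2 + phi))
    = p * q * cos phi.
Proof.
move=> ia ib mu mv hp hq phi.
pose h (z : T1 * T2) := cos (u z.1 + v z.2 + phi).
have mh : measurable_fun setT h.
  apply: measurableT_comp; first exact: continuous_measurable_fun (@continuous_cos R).
  apply: measurable_funD => //; apply: measurable_funD.
    exact: (measurableT_comp mu measurable_fst).
  exact: (measurableT_comp mv measurable_snd).
have hM z : `|h z| <= 1 by exact: cos_max.
have mh1 x : measurable_fun setT (fun y => h (x, y)) by exact: measurableT_comp.
have := integral12_prod_meas1 (integrable_tensor_bounded ia ib mh hM).
rewrite {1}/Rintegral => <-.
transitivity (Rintegral m1 setT (fun x => q * (a x * cos (u x + phi)))).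
  rewrite /Rintegral; congr fine; apply: eq_integral => x _.
  rewrite /fubini_F /=.
  have -> : q * (a x * cos (u x + phi)) = a x * Rintegral m2 setT (fun y => b y * h (x, y)).
    rewrite mulrCA -hq; congr (_ * _); apply: eq_Rintegral => y _; rewrite /h /=.
    by congr (_ * cos _); rewrite addrCA addrA.
  rewrite EFinM EFin_Rintegral; last exact: (integrable_mul_bounded ib (mh1 x)).
  rewrite -integralZl//; last exact: (integrable_mul_bounded ib (mh1 x)).
  by apply: eq_integral => y _; rewrite -EFinM mulrA.
rewrite RintegralZl// ?hp; first by ring.
apply: (integrable_mul_bounded ia (M := 1)) => [|x]; last exact: cos_max.
apply: measurableT_comp; first exact: continuous_measurable_fun (@continuous_cos R).
exact: measurable_funD.
Qed.
End fubini.

(** * Schur's test and weighted square bounds for oscillatory integrals *)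

Section schur.
Context d1 d2 (T1 : measurableType d1) (T2 : measurableType d2) (R : realType).
Variable m1 : {sigma_finite_measure set T1 -> \bar R}.
Variable m2 : {sigma_finite_measure set T2 -> \bar R}.

Lemma normr_Rintegral_le d (T : measurableType d) (m : {measure set T -> \bar R}) (g : T -> R) :
  measurable_fun setT g ->
  (`|Rintegral m setT g|%:E <= \int[m]_x `|g x|%:E)%E.
Proof.
move=> mg; have [h|] := ltP (\int[m]_x `|g x|%:E)%E +oo%E; last first.
  by rewrite leye_eq => /eqP ->; rewrite leey.
have ig : m.-integrable setT (EFin \o g) by apply/integrableP; split => //; exact/measurable_EFinP.
rewrite EFin_normr_Rintegral//; apply: le_abse_integral => //; exact/measurable_EFinP.
Qed.

(** The product of [|f y|] and [|f x|] is at most half the sum of their squares, split below into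
    [P] and [Q]. Tonelli and the symmetry of [H] give both halves the same integral, which the row
    bound [B] controls. *)
Lemma ge0_schur_test (f : T2 -> R) (H : T2 * T2 -> R) (B : R) :
  0 <= B -> measurable_fun setT f -> measurable_fun setT H ->
  (forall z, 0 <= H z) -> (forall x y, H (x, y) = H (y, x)) ->
  (forall y, (\int[m2]_x (H (y, x))%:E <= B%:E)%E) ->
  (\int[m2]_y \int[m2]_x (`|f y| * (`|f x| * H (y, x)))%:E <= B%:E * \int[m2]_y (f y ^+ 2)%:E)%E.
Proof.
move=> b0 mf mH H0 Hs HB.
have mH1 y : measurable_fun setT (fun x => H (y, x)) by exact: measurableT_comp.
have mf2 : measurable_fun setT (fun y => f y ^+ 2) by exact: measurable_funX.
pose P (z : T2 * T2) := (2^-1 * (f z.1 ^+ 2 * H z))%:E.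
pose Q (z : T2 * T2) := (2^-1 * (f z.2 ^+ 2 * H z))%:E.
have mP : measurable_fun setT P.
  apply/measurable_EFinP; apply: measurable_funM => //; apply: measurable_funM => //.
  exact: (measurableT_comp mf2 measurable_fst).
have mQ : measurable_fun setT Q.
  apply/measurable_EFinP; apply: measurable_funM => //; apply: measurable_funM => //.
  exact: (measurableT_comp mf2 measurable_snd).
have P0 z : (0 <= P z)%E.
  by rewrite lee_fin mulr_ge0 ?invr_ge0// mulr_ge0// sqr_ge0.
have Q0 z : (0 <= Q z)%E.
  by rewrite lee_fin mulr_ge0 ?invr_ge0// mulr_ge0// sqr_ge0.
have mP1 y : measurable_fun setT (fun x => P (y, x)) by exact: measurableT_comp.
have mQ1 y : measurable_fun setT (fun x => Q (y, x)) by exact: measurableT_comp.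
have mQ2 y : measurable_fun setT (fun x => Q (x, y)) by exact: measurableT_comp.
have mPF : measurable_fun setT (fun y => \int[m2]_x P (y, x))%E.
  exact: measurable_fun_fubini_tonelli_F.
have mQF : measurable_fun setT (fun y => \int[m2]_x Q (y, x))%E.
  exact: measurable_fun_fubini_tonelli_F.
have mN : measurable_fun setT (fun z : T2 * T2 => (`|f z.1| * (`|f z.2| * H z))%:E).
  apply/measurable_EFinP; apply: measurable_funM.
    by apply: measurableT_comp => //; exact: (measurableT_comp mf measurable_fst).
  apply: measurable_funM => //.
  by apply: measurableT_comp => //; exact: (measurableT_comp mf measurable_snd).
have mN1 y : measurable_fun setT (fun x => (`|f y| * (`|f x| * H (y, x)))%:E).
  exact: (measurableT_comp mN (measurable_pair1 y)).
have half y : (\int[m2]_x P (y, x) <= (2^-1 * B)%:E * (f y ^+ 2)%:E)%E.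
  have -> : (\int[m2]_x P (y, x) = (2^-1 * f y ^+ 2)%:E * \int[m2]_x (H (y, x))%:E)%E.
    rewrite -ge0_integralZl//.
    - by apply: eq_integral => x _; rewrite -EFinM /P /= mulrA.
    - exact/measurable_EFinP.
    - by move=> x _; rewrite lee_fin.
    - by rewrite lee_fin mulr_ge0 ?sqr_ge0 ?invr_ge0.
  apply: (@le_trans _ _ ((2^-1 * f y ^+ 2)%:E * B%:E)%E).
    by apply: lee_wpmul2l => //; rewrite lee_fin mulr_ge0 ?sqr_ge0 ?invr_ge0.
  by rewrite -!EFinM lee_fin mulrAC.
have I2 : (\int[m2]_y ((2^-1 * B)%:E * (f y ^+ 2)%:E) <= (2^-1 * B)%:E * \int[m2]_y (f y ^+ 2)%:E)%E.
  rewrite ge0_integralZl//.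
  - exact/measurable_EFinP.
  - by move=> y _; rewrite lee_fin sqr_ge0.
  - by rewrite lee_fin mulr_ge0// invr_ge0.
apply: (@le_trans _ _ (\int[m2]_y (\int[m2]_x P (y, x) + \int[m2]_x Q (y, x)))%E).
  apply: ge0_le_integral => //.
  - by move=> y _; apply: integral_ge0 => x _; rewrite lee_fin !mulr_ge0.
  - apply: (measurable_fun_fubini_tonelli_F _ mN).
    by move=> z; rewrite lee_fin !mulr_ge0.
  - exact: emeasurable_funD.
  - move=> y _; rewrite -ge0_integralD//.
    apply: ge0_le_integral => //.
    + by move=> x _; rewrite lee_fin !mulr_ge0.
    + exact: emeasurable_funD.
    + move=> x _; rewrite /P /Q /= -EFinD lee_fin mulrA -mulrDr -mulrDl mulrA.
      apply: ler_wpM2r => //.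
      have := sqr_ge0 (`|f y| - `|f x|).
      rewrite -[f y ^+ 2]real_normK ?num_real// -[f x ^+ 2]real_normK ?num_real// => h.
      by nra.
rewrite ge0_integralD//; last 2 first.
  by move=> y _; apply: integral_ge0.
  by move=> y _; apply: integral_ge0.
have -> : (B%:E * \int[m2]_y (f y ^+ 2)%:E = (2^-1 * B)%:E * \int[m2]_y (f y ^+ 2)%:E +
   (2^-1 * B)%:E * \int[m2]_y (f y ^+ 2)%:E)%E.
  have b2 : (0 <= (2^-1 * B)%:E)%E by rewrite lee_fin mulr_ge0 ?invr_ge0.
  rewrite -[in RHS]ge0_muleDl//.
  by rewrite -EFinD; congr (_%:E * _)%E; field.
have mB : measurable_fun setT (fun y => (2^-1 * B)%:E * (f y ^+ 2)%:E)%E.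
  by apply: emeasurable_funM => //; exact/measurable_EFinP.
have IP : (\int[m2]_y \int[m2]_x P (y, x) <= \int[m2]_y ((2^-1 * B)%:E * (f y ^+ 2)%:E))%E.
  by apply: ge0_le_integral => // y _; apply: integral_ge0.
apply: leeD; first exact: le_trans IP I2.
rewrite (@fubini_tonelli _ _ _ _ _ m2 m2 Q mQ Q0).
apply: (le_trans _ I2); apply: (le_trans _ IP).
under eq_integral => y _ do under eq_integral => x _ do
  (rewrite (_ : Q (x, y) = P (y, x)); last by rewrite /P /Q /= Hs).
exact: lexx.
Qed.

(** Expanding the squares and integrating in [xi] first leaves a quadratic form in [f] whose kernel
    is the transform of the weight. Integrability of [W] justifies the exchange, and Schur's test
    applies to the majorant [H]. *)
Lemma fourier_schur_bound (W : T1 -> R) (f : T2 -> R) (c s : T1 * T2 -> R) (H : T2 * T2 -> R)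
    (B : R) :
  0 <= B -> (forall xi, 0 <= W xi) -> m1.-integrable setT (EFin \o W) ->
  m2.-integrable setT (EFin \o f) ->
  measurable_fun setT c -> measurable_fun setT s ->
  (forall z, `|c z| <= 1) -> (forall z, `|s z| <= 1) ->
  measurable_fun setT H -> (forall z, 0 <= H z) -> (forall x y, H (x, y) = H (y, x)) ->
  (forall y, (\int[m2]_x (H (y, x))%:E <= B%:E)%E) ->
  (forall y x, `|Rintegral m1 setT
     (fun xi => W xi * (c (xi, x) * c (xi, y) + s (xi, x) * s (xi, y)))| <= H (y, x)) ->
  (\int[m1]_xi (W xi * (Rintegral m2 setT (fun y => f y * c (xi, y)) ^+ 2 +
                        Rintegral m2 setT (fun y => f y * s (xi, y)) ^+ 2))%:E
   <= B%:E * \int[m2]_y (f y ^+ 2)%:E)%E.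
Proof.
move=> B0 W0 iW intf mc ms c1 s1 mH H0 Hs HB Hk.
have mf : measurable_fun setT f by apply/measurable_EFinP/(measurable_int m2).
have mW : measurable_fun setT W by apply/measurable_EFinP/(measurable_int m1).
set Fc := fun xi => Rintegral m2 setT (fun y => f y * c (xi, y)).
set Fs := fun xi => Rintegral m2 setT (fun y => f y * s (xi, y)).
have mFc : measurable_fun setT Fc by exact: measurable_Rintegral_param.
have mFs : measurable_fun setT Fs by exact: measurable_Rintegral_param.
have mc1 xi : measurable_fun setT (fun y => c (xi, y)) by exact: measurableT_comp.
have ms1 xi : measurable_fun setT (fun y => s (xi, y)) by exact: measurableT_comp.
have mc2 y : measurable_fun setT (fun xi => c (xi, y)) by exact: measurableT_comp.
have ms2 y : measurable_fun setT (fun xi => s (xi, y)) by exact: measurableT_comp.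
(* The integral of [|f|] bounds both transforms, which makes [h] below bounded, as the exchange of
   integrals requires. *)
pose N := Rintegral m2 setT (fun y => `|f y|).
have inf : m2.-integrable setT (EFin \o (fun y => `|f y|)) by exact: integrable_norm.
have bnd (g : T2 -> R) : measurable_fun setT g -> (forall y, `|g y| <= 1) ->
    `|Rintegral m2 setT (fun y => f y * g y)| <= N.
  move=> mg g1; apply: (le_trans (le_normr_Rintegral _ _)) => //.
    exact: (integrable_mul_bounded intf mg g1).
  apply: le_Rintegral => //.
    apply: integrable_norm; exact: (integrable_mul_bounded intf mg g1).
  by move=> y _; rewrite normrM ler_piMr.
have bFc xi : `|Fc xi| <= N by apply: bnd.
have bFs xi : `|Fs xi| <= N by apply: bnd.
have N0 : 0 <= N by apply: Rintegral_ge0.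
pose h (z : T1 * T2) := Fc z.1 * c z + Fs z.1 * s z.
have mh : measurable_fun setT h.
  apply: measurable_funD; apply: measurable_funM => //.
    exact: (measurableT_comp mFc measurable_fst).
  exact: (measurableT_comp mFs measurable_fst).
have hb z : `|h z| <= N + N.
  apply: (le_trans (ler_normD _ _)); rewrite !normrM; apply: lerD.
    by rewrite -[leRHS]mulr1; apply: ler_pM.
  by rewrite -[leRHS]mulr1; apply: ler_pM.
have mh1 xi : measurable_fun setT (fun y => h (xi, y)) by exact: measurableT_comp.
have mh2 y : measurable_fun setT (fun xi => h (xi, y)) by exact: measurableT_comp.
(* Only one factor of each square is expanded; the other stays inside [h]. The double integral is
   thus unfolded by two successive exchanges rather than by a triple integral. *)
have sq xi : Fc xi ^+ 2 + Fs xi ^+ 2 = Rintegral m2 setT (fun y => f y * h (xi, y)).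
  have -> : (fun y => f y * h (xi, y)) =
      (fun y => Fc xi * (f y * c (xi, y)) + Fs xi * (f y * s (xi, y))).
    by apply/funext => y; rewrite /h /=; ring.
  have ic := integrable_mul_bounded intf (mc1 xi) (fun y => c1 (xi, y)).
  have is_ := integrable_mul_bounded intf (ms1 xi) (fun y => s1 (xi, y)).
  rewrite RintegralD//; last 2 first.
    exact: (integrableZl measurableT (Fc xi) ic).
    exact: (integrableZl measurableT (Fs xi) is_).
  by rewrite !RintegralZl// !expr2.
pose k y x := Rintegral m1 setT
     (fun xi => W xi * (c (xi, x) * c (xi, y) + s (xi, x) * s (xi, y))).
(* The second exchange expands the transforms that remain in [h] and produces the kernel [k]. *)
have Gk y : Rintegral m1 setT (fun xi => W xi * h (xi, y)) =
    Rintegral m2 setT (fun x => f x * k y x).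
  pose g (z : T1 * T2) := c z * c (z.1, y) + s z * s (z.1, y).
  have mg : measurable_fun setT g.
    apply: measurable_funD; apply: measurable_funM => //.
      exact: (measurableT_comp (mc2 y) measurable_fst).
    exact: (measurableT_comp (ms2 y) measurable_fst).
  have gb z : `|g z| <= 1 + 1.
    apply: (le_trans (ler_normD _ _)); rewrite !normrM; apply: lerD; exact: mulr_ile1.
  rewrite /k -(Rintegral_exchange iW intf mg gb).
  apply: eq_Rintegral => xi _; congr (_ * _); rewrite /h /g /=.
  have -> : (fun x => f x * (c (xi, x) * c (xi, y) + s (xi, x) * s (xi, y))) =
      (fun x => c (xi, y) * (f x * c (xi, x)) + s (xi, y) * (f x * s (xi, x))).
    by apply/funext => x; ring.
  have ic := integrable_mul_bounded intf (mc1 xi) (fun y => c1 (xi, y)).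
  have is_ := integrable_mul_bounded intf (ms1 xi) (fun y => s1 (xi, y)).
  rewrite RintegralD//; last 2 first.
    exact: (integrableZl measurableT _ ic).
    exact: (integrableZl measurableT _ is_).
  by rewrite !RintegralZl// mulrC [Fs _ * _]mulrC.
have iWh y : m1.-integrable setT (fun xi => (W xi * h (xi, y))%:E).
  exact: (integrable_mul_bounded iW (mh2 y) (fun xi => hb (xi, y))).
have -> : (\int[m1]_xi (W xi * (Fc xi ^+ 2 + Fs xi ^+ 2))%:E =
    (Rintegral m2 setT (fun y => f y * Rintegral m1 setT (fun xi => W xi * h (xi, y))))%:E)%E.
  rewrite -(Rintegral_exchange iW intf mh hb) EFin_Rintegral.
    by apply: eq_integral => xi _; rewrite sq.
  under eq_fun do rewrite /= -sq.
  apply: (integrable_mul_bounded (M := N ^+ 2 + N ^+ 2) iW).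
    by apply: measurable_funD; exact: measurable_funX.
  move=> xi; rewrite ger0_norm ?addr_ge0 ?sqr_ge0//.
  rewrite -[Fc xi ^+ 2]real_normK ?num_real// -[Fs xi ^+ 2]real_normK ?num_real//.
  by apply: lerD; apply: lerXn2r; rewrite ?nnegrE.
apply: le_trans (ge0_schur_test B0 mf mH H0 Hs HB).
under eq_Rintegral => y _ do rewrite Gk.
have mN : measurable_fun setT (fun z : T2 * T2 => (`|f z.1| * (`|f z.2| * H z))%:E).
  apply/measurable_EFinP; apply: measurable_funM.
    by apply: measurableT_comp => //; exact: (measurableT_comp mf measurable_fst).
  apply: measurable_funM => //.
  by apply: measurableT_comp => //; exact: (measurableT_comp mf measurable_snd).
have N0' (z : T2 * T2) : (0 <= (`|f z.1| * (`|f z.2| * H z))%:E)%E by rewrite lee_fin !mulr_ge0.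
have mN1 y : measurable_fun setT (fun x => (`|f y| * (`|f x| * H (y, x)))%:E).
  exact: (measurableT_comp mN (measurable_pair1 y)).
have mG : measurable_fun setT (fun y => Rintegral m1 setT (fun xi => W xi * h (xi, y))).
  have msw : measurable_fun setT (fun z : T2 * T1 => h (z.2, z.1)).
    apply: measurableT_comp mh _; exact: measurable_fun_pair.
  exact: (measurable_Rintegral_param m1 mW msw).
have mfG : measurable_fun setT (fun y => (f y * Rintegral m2 setT (fun x => f x * k y x))%:E).
  apply/measurable_EFinP; apply: measurable_funM => //.
  by under eq_fun do rewrite -Gk.
have key y : (`|(f y * Rintegral m2 setT (fun x => f x * k y x))%:E| <=
    \int[m2]_x (`|f y| * (`|f x| * H (y, x)))%:E)%E.
  have mg : measurable_fun setT (fun x => f x * k y x).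
    apply: measurable_funM => //.
    have msw : measurable_fun setT (fun z : T2 * T1 =>
        c (z.2, z.1) * c (z.2, y) + s (z.2, z.1) * s (z.2, y)).
      apply: measurable_funD; apply: measurable_funM.
      - by apply: (measurableT_comp mc); exact: measurable_fun_pair.
      - exact: (measurableT_comp (mc2 y) measurable_snd).
      - by apply: (measurableT_comp ms); exact: measurable_fun_pair.
      - exact: (measurableT_comp (ms2 y) measurable_snd).
    exact: (measurable_Rintegral_param m1 mW msw).
  rewrite EFinM abseM /=.
  apply: (@le_trans _ _ (`|f y|%:E * \int[m2]_x `|f x * k y x|%:E)%E).
    by apply: lee_wpmul2l; rewrite ?lee_fin//; exact: normr_Rintegral_le.
  rewrite -ge0_integralZl//.
  - apply: ge0_le_integral => //.
    + apply: emeasurable_funM => //; apply/measurable_EFinP; exact: measurableT_comp.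
    + move=> x _; rewrite -EFinM lee_fin; apply: ler_wpM2l => //.
      by rewrite normrM; apply: ler_wpM2l => //; exact: Hk.
  - by apply/measurable_EFinP; exact: measurableT_comp.
apply: (le_trans (_ : _ <= `|Rintegral m2 setT (fun y => f y * Rintegral m2 setT (fun x => f x * k y x))|%:E)%E).
  by rewrite lee_fin ler_norm.
apply: (le_trans (normr_Rintegral_le _ _)); first exact/measurable_EFinP.
apply: ge0_le_integral => //.
- by apply/measurable_EFinP; apply: measurableT_comp => //; exact/measurable_EFinP.
- exact: (measurable_fun_fubini_tonelli_F _ mN N0').
- by move=> y _; exact: key.
Qed.
End schur.

(** * The parabolic window on the line, its cosine transform and a Cauchy majorant *)

Section welch_kernel.
Variable R : realType.
Let mu := @lebesgue_measure R.
Implicit Types N s t a phi : R.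

(** Vanishing at both ends of the interval gives the cosine transform decay of order [s ^ -2], hence
    integrability, while the window is still a polynomial with an explicit transform. *)
Definition welch N : R -> R := (fun t => 1 - (t / N) ^+ 2) \_ `[- N, N].

Lemma welch_ge0 N t : 0 < N -> 0 <= welch N t.
Proof.
move=> N0; rewrite /welch patchE; case: ifPn => // /[!inE] /=.
rewrite in_itv /= -ler_norml => h; rewrite subr_ge0 -real_normK ?num_real//.
by rewrite exprn_ile1// normrM normfV (gtr0_norm N0) ler_pdivrMr// mul1r.
Qed.

Lemma welch_le1 N t : welch N t <= 1.
Proof.
by rewrite /welch patchE; case: ifPn => // _; rewrite gerBl sqr_ge0.
Qed.

Lemma continuous_welch_poly N : continuous (fun t : R => 1 - (t / N) ^+ 2).
Proof.
move=> t; apply: cvgB; first exact: cvg_cst.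
apply: (@continuous_comp _ _ _ (fun t : R => t / N) (fun x => x ^+ 2)).
  by apply: cvgM; [exact: cvg_id|exact: cvg_cst].
exact: exprn_continuous.
Qed.

Lemma measurable_welch N : measurable_fun setT (welch N).
Proof.
apply/(measurable_restrictT _ _).1 => //.
by apply: measurable_funTS; apply: continuous_measurable_fun; exact: continuous_welch_poly.
Qed.

Lemma integrable_welch N : mu.-integrable setT (EFin \o welch N).
Proof.
rewrite /welch -restrict_EFin; apply/integrable_restrict => //; rewrite setTI.
apply: continuous_compact_integrable => //; first exact: segment_compact.
by apply: continuous_subspaceT; exact: continuous_welch_poly.
Qed.

Lemma is_derive_sin_affine s phi t :
  is_derive t 1 (fun t => sin (t * s + phi)) (s * cos (t * s + phi)).
Proof.
have h : is_derive t 1 (fun t : R => t * s + phi) s.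
  by apply: is_derive_eq; rewrite /= addr0 scaler0 add0r scaler1.
rewrite mulrC; exact: (is_derive1_comp (f := @sin R) (g := fun t : R => t * s + phi)).
Qed.

Lemma is_derive_cos_affine s phi t :
  is_derive t 1 (fun t => cos (t * s + phi)) (- s * sin (t * s + phi)).
Proof.
have h : is_derive t 1 (fun t : R => t * s + phi) s.
  by apply: is_derive_eq; rewrite /= addr0 scaler0 add0r scaler1.
rewrite mulNr mulrC -mulNr; exact: (is_derive1_comp (f := @cos R) (g := fun t : R => t * s + phi)).
Qed.

(** Closed form of the cosine transform for nonzero [s]. At [s = 0] division by zero makes it 0,
    which is not the value of the transform; [welch_ft] is therefore defined as the integral. *)
Definition welch_hat N s := 4 * sin (N * s) / (N ^+ 2 * s ^+ 3) - 4 * cos (N * s) / (N * s ^+ 2).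

Lemma Rintegral_welch_cos_neq0 N s phi : 0 < N -> s != 0 ->
  Rintegral mu setT (fun t => welch N t * cos (t * s + phi)) = welch_hat N s * cos phi.
Proof.
move=> N0 s0.
have -> : (fun t => welch N t * cos (t * s + phi)) =
    (fun t => (1 - (t / N) ^+ 2) * cos (t * s + phi)) \_ `[- N, N].
  by apply/funext => t; rewrite /welch !patchE; case: ifP => // _; rewrite mul0r.
rewrite -Rintegral_mkcond /Rintegral.
(* Antiderivative obtained by integrating by parts twice; its first term vanishes at both
   endpoints. *)
pose G t := (1 - (t / N) ^+ 2) * sin (t * s + phi) / s
  - 2 * t * cos (t * s + phi) / (N ^+ 2 * s ^+ 2) + 2 * sin (t * s + phi) / (N ^+ 2 * s ^+ 3).
have dG t : is_derive t 1 G ((1 - (t / N) ^+ 2) * cos (t * s + phi)).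
  have hs := is_derive_sin_affine s phi t.
  have hc := is_derive_cos_affine s phi t.
  rewrite /G; apply: is_derive_eq.
  rewrite /= /GRing.scale /=; field.
  by rewrite s0 (gt_eqF N0).
have cG : continuous G.
  by move=> t; apply/differentiable_continuous/derivable1_diffP; have [] := dG t.
rewrite (@continuous_FTC2 _ _ G).
- rewrite -EFinB /= /G /welch_hat mulNr !mulNr !expr2 ?mulNr.
  rewrite !mulrN !mulNr !sinD !cosD !sinN !cosN; field.
  by rewrite s0 (gt_eqF N0).
- by rewrite gtrN.
- apply: continuous_subspaceT => t; apply: cvgM; first exact: continuous_welch_poly.
  apply: (@continuous_comp _ _ _ (fun t => t * s + phi) cos); last exact: continuous_cos.
  by apply: cvgD; [apply: cvgM; [exact: cvg_id|exact: cvg_cst]|exact: cvg_cst].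
- split.
  + by move=> t _; have [] := dG t.
  + by apply: cvg_at_right_filter; exact: cG.
  + by apply: cvg_at_left_filter; exact: cG.
- by move=> t _; rewrite derive1E; apply: derive_val.
Qed.

Definition welch_ft N s := Rintegral mu setT (fun t => welch N t * cos (t * s)).

(** The window is even, so the sine part of the addition formula integrates to zero. The case
    [s = 0] is separate because the closed form fails there. *)
Lemma Rintegral_welch_cos N s phi : 0 < N ->
  Rintegral mu setT (fun t => welch N t * cos (t * s + phi)) = welch_ft N s * cos phi.
Proof.
move=> N0; rewrite /welch_ft; have [->|s0] := eqVneq s 0.
  under eq_Rintegral => t _ do rewrite mulr0 add0r.
  under [X in _ = X * _]eq_Rintegral => t _ do rewrite mulr0 cos0 mulr1.
  by rewrite RintegralZr//; exact: integrable_welch.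
rewrite Rintegral_welch_cos_neq0//; congr (_ * _).
have := Rintegral_welch_cos_neq0 0 N0 s0; rewrite cos0 mulr1 => <-.
by apply: eq_Rintegral => t _; rewrite addr0.
Qed.

Definition cauchy_kernel N s := 16 * N / (4 + N ^+ 2 * s ^+ 2).

Lemma cauchy_kernel_ge0 N s : 0 < N -> 0 <= cauchy_kernel N s.
Proof.
move=> N0; apply: divr_ge0; first by rewrite mulr_ge0// ltW.
by rewrite addr_ge0// mulr_ge0// sqr_ge0.
Qed.

Lemma Rintegral_welch_norm_le N (g : R -> R) : 0 < N -> measurable_fun setT g ->
  (forall t, `|g t| <= 1) -> `|Rintegral mu setT (fun t => welch N t * g t)| <= 2 * N.
Proof.
move=> N0 mg g1; rewrite -lee_fin.
apply: (le_trans (normr_Rintegral_le _ _)).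
  by apply: measurable_funM => //; exact: measurable_welch.
apply: (@le_trans _ _ (\int[mu]_t (\1_(`[- N, N] : set R) t)%:E)%E).
  apply: ge0_le_integral => //.
  - apply/measurable_EFinP; apply: measurableT_comp => //.
    by apply: measurable_funM => //; exact: measurable_welch.
  - by apply/measurable_EFinP; exact: measurable_indic.
  - move=> t _; rewrite lee_fin normrM indicE /welch patchE.
    case: ifPn => [h|_] /=; last by rewrite normr0 mul0r.
    rewrite -[leRHS]mulr1; apply: ler_pM => //.
    have := welch_ge0 t N0; have := welch_le1 N t.
    by rewrite /welch patchE h => h1 h0; rewrite ger0_norm.
rewrite integral_indic// setIT [X in (X <= _)%E](lebesgue_measure_itv `[- N, N]) /= lte_fin gtrN// -EFinD lee_fin.
lra.
Qed.

(** Two bounds are added: four times the trivial one, [2 * N], and the bound [8 * N] for the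
    transform multiplied by [N ^ 2 * s ^ 2], read off the closed form. This gives the constants 16
    and 4 of the kernel. *)
Lemma welch_ft_le N s : 0 < N -> `|welch_ft N s| <= cauchy_kernel N s.
Proof.
move=> N0; have h1 : `|welch_ft N s| <= 2 * N.
  apply: Rintegral_welch_norm_le => // [|t]; last exact: cos_max.
  apply: continuous_measurable_fun => t.
  apply: (@continuous_comp _ _ _ (fun t => t * s) cos); last exact: continuous_cos.
  by apply: cvgM; [exact: cvg_id|exact: cvg_cst].
have N2 : 0 < N ^+ 2 by rewrite exprn_gt0.
rewrite /cauchy_kernel ler_pdivlMr; last first.
  by apply: ltr_pwDl => //; rewrite mulr_ge0// sqr_ge0.
suff h2 : N ^+ 2 * s ^+ 2 * `|welch_ft N s| <= 8 * N.
  rewrite mulrC mulrDl; lra.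
have [->|s0] := eqVneq s 0; first by rewrite expr0n /= mulr0 mul0r mulr_ge0// ltW.
have -> : welch_ft N s = welch_hat N s.
  rewrite -[LHS]mulr1 -cos0 -Rintegral_welch_cos// Rintegral_welch_cos_neq0//.
  by rewrite cos0 mulr1.
have s2 : 0 < s ^+ 2 by rewrite exprn_even_gt0.
have -> : N ^+ 2 * s ^+ 2 * `|welch_hat N s| = `|4 * (sin (N * s) / s) - 4 * N * cos (N * s)|.
  rewrite -{1}(gtr0_norm (mulr_gt0 N2 s2)) -normrM /welch_hat; congr (`|_|).
  by field; rewrite s0 gt_eqF.
apply: (le_trans (ler_normB _ _)).
have -> : 8 * N = 4 * N + 4 * N by ring.
apply: lerD.
  rewrite normrM ger0_norm// ler_pM2l// normrM normfV ler_pdivrMr ?normr_gt0//.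
  by rewrite (le_trans (normr_sin_le _))// normrM (gtr0_norm N0).
by rewrite normrM ger0_norm ?mulr_ge0 ?(ltW N0)// ler_piMr ?cos_max// mulr_ge0// ltW.
Qed.

Lemma integral_oneDsqrV : (\int[mu]_x ((oneDsqr x)^-1)%:E = pi%:E :> \bar R)%E.
Proof.
rewrite (ge0_symfun_integralT (f := fun x : R => (oneDsqr x)^-1)).
- have -> : [set x : R | 0 <= x] = `[0, +oo[%classic.
    by apply/seteqP; split => x /=; rewrite in_itv /= andbT.
  by rewrite integral0y_oneDsqr -EFinM; congr EFin; field.
- by move=> x; rewrite invr_ge0 (le_trans ler01)// oneDsqr_ge1.
- exact: continuous_oneDsqrV.
- by move=> x /=; rewrite /oneDsqr sqrrN.
Qed.

(** The substitution [F] turns the kernel into 8 times the derivative of the arctangent. The value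
    does not depend on [N], which is what later permits [N] to tend to infinity. *)
Lemma integral_cauchy_kernel N a : 0 < N ->
  (\int[mu]_y (cauchy_kernel N (a - y))%:E = (8 * pi)%:E)%E.
Proof.
move=> N0; pose F (y : R) := (y - a) * (N / 2).
have N2 : 0 < N / 2 by rewrite divr_gt0.
have dF (y : R) : is_derive y 1 F (N / 2).
  by rewrite /F; apply: is_derive_eq; rewrite /= scaler0 add0r subr0 scaler1.
have F'E : (derive1 F) = fun=> N / 2.
  by apply/funext => y; rewrite derive1E; apply: derive_val.
have E : (\int[mu]_y (cauchy_kernel N (a - y))%:E =
  8%:E * \int[mu]_y ((((fun x => (oneDsqr x)^-1) \o F) * (derive1 F)) y)%:E)%E.
  rewrite -ge0_integralZl//.
  - apply: eq_integral => y _; rewrite -EFinM; congr EFin.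
    rewrite F'E /cauchy_kernel /oneDsqr /F /=.
    have -> : ((fun x => (1 + x ^+ 2)^-1) \o (fun y => (y - a) * (N / 2))) * (fun=> N / 2) =
      fun y => (1 + ((y - a) * (N / 2)) ^+ 2)^-1 * (N / 2) by [].
    have h1 : 4 + N ^+ 2 * (a - y) ^+ 2 != 0.
      by rewrite gt_eqF// ltr_pwDl// mulr_ge0// sqr_ge0.
    have h2 : 1 + ((y - a) * (N / 2)) ^+ 2 != 0 by rewrite gt_eqF// ltr_pwDl// sqr_ge0.
    have -> : 1 + ((y - a) * (N / 2)) ^+ 2 = (4 + N ^+ 2 * (a - y) ^+ 2) / 4 by field.
    move: h1; set D := 4 + _ => D0; by field.
  - apply/measurable_EFinP; rewrite F'E; apply: measurable_funM => //.
    apply: (@measurableT_comp _ _ _ _ _ _ (fun x : R => (oneDsqr x)^-1)).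
      by apply: continuous_measurable_fun; exact: continuous_oneDsqrV.
    by apply: measurable_funM => //; apply: measurable_funB.
  - move=> y _; rewrite lee_fin F'E; apply: mulr_ge0; last exact: ltW.
    by rewrite /= invr_ge0 (le_trans ler01)// oneDsqr_ge1.
rewrite E -increasing_ge0_integration_by_substitutionT//.
- by rewrite integral_oneDsqrV -EFinM.
- by move=> x y xy; rewrite /F ltr_pM2r// ltrD2r.
- by rewrite F'E => x; exact: cvg_cst.
- by rewrite F'E; exact: is_cvg_cst.
- by rewrite F'E; exact: is_cvg_cst.
- apply/cvgrNyPle => A.
  exists (A / (N / 2) + a); split; first exact: num_real.
  by move=> x hx; rewrite /F -ler_pdivlMr// lerBlDr ltW.
- apply/cvgryPge => A.
  exists (A / (N / 2) + a); split; first exact: num_real.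
  by move=> x hx; rewrite /F -ler_pdivrMr// lerBrDr ltW.
- exact: continuous_oneDsqrV.
Qed.

Lemma measurable_cauchy_kernel N : measurable_fun setT (cauchy_kernel N).
Proof.
apply: continuous_measurable_fun => s; apply: cvgM; first exact: cvg_cst.
apply: cvgV; first by rewrite gt_eqF// ltr_pwDl// mulr_ge0// sqr_ge0.
apply: cvgD; first exact: cvg_cst.
by apply: cvgM; [exact: cvg_cst|exact: exprn_continuous].
Qed.

Lemma welch_nondecreasing N N' t : 0 < N -> N <= N' -> welch N t <= welch N' t.
Proof.
move=> N0 NN'; have N'0 : 0 < N' by exact: lt_le_trans NN'.
rewrite {1}/welch patchE; case: ifPn => [/[!inE] /=|_]; last exact: welch_ge0.
rewrite in_itv /= -ler_norml => h.
rewrite /welch patchE ifT; last by rewrite inE /= in_itv /= -ler_norml (le_trans h).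
rewrite lerD2l lerN2 !exprMn; apply: ler_wpM2l; first exact: sqr_ge0.
by apply: lerXn2r; rewrite ?nnegrE ?invr_ge0 ?(ltW N0) ?(ltW N'0)// lef_pV2.
Qed.

Lemma cvg_welch t : welch n.+1%:R t @[n --> \oo] --> (1 : R).
Proof.
have h : (fun n : nat => 1 - (t * n.+1%:R^-1) ^+ 2) @ \oo --> 1 - (t * 0) ^+ 2.
  apply: cvgB; first exact: cvg_cst.
  apply: (@cvg_comp _ _ _ (fun n : nat => t * n.+1%:R^-1) (fun x => x ^+ 2) _ (nbhs (t * 0))).
    by apply: cvgM; [exact: cvg_cst|exact: cvg_harmonic].
  exact: exprn_continuous.
rewrite mulr0 expr0n /= subr0 in h.
apply: cvg_trans h; apply: near_eq_cvg.
exists (Num.truncn `|t|) => // n /= hn.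
rewrite /welch patchE ifT// inE /= in_itv /= -ler_norml.
apply/ltW/(lt_le_trans (truncnS_gt _)).
by rewrite ler_nat ltnS.
Qed.
End welch_kernel.

(** * Sigma-finiteness of product measures *)

Section leb3_sigma_finite.

(** Products of the terms of two increasing exhausting sequences exhaust the product, the larger of
    two indices serving both factors. *)
Lemma sigma_finite_product d1 d2 (T1 : measurableType d1) (T2 : measurableType d2) (R : realType)
    (m1 : {sigma_finite_measure set T1 -> \bar R}) (m2 : {sigma_finite_measure set T2 -> \bar R}) :
  sigma_finite setT (m1 \x m2)%E.
Proof.
have /sigma_finiteP[F [TF ndF Foo]] := sigma_finiteT m1.
have /sigma_finiteP[G [TG ndG Goo]] := sigma_finiteT m2.
exists (fun n => F n `*` G n).
  rewrite -setXTT TF TG predeqE => -[x y]; split.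
    move=> [/= [n _ Fnx] [k _ Gky]]; exists (maxn n k) => //; split.
    - by move: x Fnx; exact/subsetPset/ndF/leq_maxl.
    - by move: y Gky; exact/subsetPset/ndG/leq_maxr.
  by move=> [n _ []/= ? ?]; split; exists n.
move=> k; have [? ?] := Foo k; have [? ?] := Goo k.
split; first exact: measurableX.
by rewrite product_measure1E//; apply: lte_mul_pinfty => //; rewrite ge0_fin_numE.
Qed.

Variable R : realType.

(* The instances below are needed because the library's sigma-finiteness
   instance of products is superseded there by the one for subprobabilities. *)
Definition leb2 := ((@lebesgue_measure R) \x (@lebesgue_measure R))%E.

HB.instance Definition _ := Measure.on leb2.
HB.instance Definition _ := Measure_isSigmaFinite.Build _ _ _ leb2
  (sigma_finite_product (@lebesgue_measure R) (@lebesgue_measure R)).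

HB.instance Definition _ := Measure.on (@leb3 R).
HB.instance Definition _ := Measure_isSigmaFinite.Build _ _ _ (@leb3 R)
  (sigma_finite_product leb2 (@lebesgue_measure R)).

End leb3_sigma_finite.

(** * Tensor integrals in three dimensions and the upper half of Plancherel's theorem *)

Section leb3_integrals.
Variable R : realType.
Let mu := @lebesgue_measure R.
Let mu3 := @leb3 R.
Implicit Types (N : R) (x y xi : pt3 R).

Lemma measurable_pt3_coord1 : measurable_fun setT (fun y : pt3 R => y.1.1).
Proof. by apply: (measurableT_comp measurable_fst); exact: measurable_fst. Qed.

Lemma measurable_pt3_coord2 : measurable_fun setT (fun y : pt3 R => y.1.2).
Proof. by apply: (measurableT_comp measurable_snd); exact: measurable_fst. Qed.

Lemma measurable_pt3_coord3 : measurable_fun setT (fun y : pt3 R => y.2).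
Proof. exact: measurable_snd. Qed.

Lemma measurable_dot3 : measurable_fun setT (fun z : pt3 R * pt3 R => dot3 z.1 z.2).
Proof.
have h1 := measurable_pt3_coord1; have h2 := measurable_pt3_coord2.
have h3 := measurable_pt3_coord3.
apply: measurable_funD; first apply: measurable_funD; apply: measurable_funM.
- exact: (measurableT_comp h1 measurable_fst).
- exact: (measurableT_comp h1 measurable_snd).
- exact: (measurableT_comp h2 measurable_fst).
- exact: (measurableT_comp h2 measurable_snd).
- exact: (measurableT_comp h3 measurable_fst).
- exact: (measurableT_comp h3 measurable_snd).
Qed.

Lemma measurable_cos_dot3 : measurable_fun setT (fun z : pt3 R * pt3 R => cos (dot3 z.1 z.2)).
Proof.
apply: measurableT_comp measurable_dot3.
exact: continuous_measurable_fun (@continuous_cos R).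
Qed.

Lemma measurable_sin_dot3 : measurable_fun setT (fun z : pt3 R * pt3 R => sin (dot3 z.1 z.2)).
Proof.
apply: measurableT_comp measurable_dot3.
exact: continuous_measurable_fun (@continuous_sin R).
Qed.

Definition tensor3 (f g h : R -> R) (x : pt3 R) := f x.1.1 * g x.1.2 * h x.2.

Lemma measurable_tensor3 (f g h : R -> R) : measurable_fun setT f -> measurable_fun setT g ->
  measurable_fun setT h -> measurable_fun setT (tensor3 f g h).
Proof.
move=> mf mg mh; apply: measurable_funM; first apply: measurable_funM.
- exact: (measurableT_comp mf measurable_pt3_coord1).
- exact: (measurableT_comp mg measurable_pt3_coord2).
- exact: (measurableT_comp mh measurable_pt3_coord3).
Qed.

Lemma ge0_integral_tensor3 (f g h : R -> R) :
  measurable_fun setT f -> measurable_fun setT g -> measurable_fun setT h ->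
  (forall t, 0 <= f t) -> (forall t, 0 <= g t) -> (forall t, 0 <= h t) ->
  (\int[mu3]_x (tensor3 f g h x)%:E =
   \int[mu]_t (f t)%:E * \int[mu]_t (g t)%:E * \int[mu]_t (h t)%:E)%E.
Proof.
move=> mf mg mh f0 g0 h0.
have mfg : measurable_fun setT (fun z : R * R => f z.1 * g z.2).
  apply: measurable_funM.
    exact: (measurableT_comp mf measurable_fst).
  exact: (measurableT_comp mg measurable_snd).
rewrite -(@ge0_integral_tensor _ _ _ _ _ mu mu)//.
by rewrite -(@ge0_integral_tensor _ _ _ _ _ (@leb2 R) mu)// => z; rewrite mulr_ge0.
Qed.

Lemma integrable_tensor3 (f g h : R -> R) :
  mu.-integrable setT (EFin \o f) -> mu.-integrable setT (EFin \o g) ->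
  mu.-integrable setT (EFin \o h) ->
  mu3.-integrable setT (EFin \o tensor3 f g h).
Proof.
move=> intf intg inth.
exact: (@integrable_tensor _ _ _ _ _ (@leb2 R) mu (fun z => f z.1 * g z.2) h
  (integrable_tensor intf intg)).
Qed.

Definition welch3 N := tensor3 (welch N) (welch N) (welch N).

Lemma welch3_ge0 N x : 0 < N -> 0 <= welch3 N x.
Proof. by move=> N0; rewrite !mulr_ge0 ?welch_ge0. Qed.

(** The tensor rule is used twice; the first use keeps its phase free, as the second one needs. *)
Lemma Rintegral_welch3_cos N (s : pt3 R) : 0 < N ->
  Rintegral mu3 setT (fun xi => welch3 N xi * cos (dot3 xi s)) =
  welch_ft N s.1.1 * welch_ft N s.1.2 * welch_ft N s.2.
Proof.
move=> N0; have iw := integrable_welch N.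
have ml (r : R) : measurable_fun setT (fun t : R => t * r) by exact: measurable_funM.
have h2 := @Rintegral_tensor_cos _ _ _ _ _ mu mu _ _ _ _ _ _ iw iw (ml s.1.1) (ml s.1.2)
  (fun phi => Rintegral_welch_cos s.1.1 phi N0) (fun phi => Rintegral_welch_cos s.1.2 phi N0).
have m2 : measurable_fun setT (fun z : R * R => z.1 * s.1.1 + z.2 * s.1.2).
  apply: measurable_funD.
    exact: (measurableT_comp (ml s.1.1) measurable_fst).
  exact: (measurableT_comp (ml s.1.2) measurable_snd).
have h3 := @Rintegral_tensor_cos _ _ _ _ _ (@leb2 R) mu _ _ _ _ _ _
  (integrable_tensor iw iw) iw m2 (ml s.2) h2 (fun phi => Rintegral_welch_cos s.2 phi N0).
by rewrite -[RHS]mulr1 -cos0 -h3; apply: eq_Rintegral => xi _; rewrite addr0.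
Qed.

Definition cauchy3 N x :=
  cauchy_kernel N x.1.1 * cauchy_kernel N x.1.2 * cauchy_kernel N x.2.

Lemma integral_cauchy3 N x : 0 < N ->
  (\int[mu3]_y (cauchy3 N (sub3 x y))%:E = ((8 * pi) ^+ 3)%:E)%E.
Proof.
move=> N0.
have mk (a : R) : measurable_fun setT (fun t : R => cauchy_kernel N (a - t)).
  by apply: (measurableT_comp (measurable_cauchy_kernel N)); exact: measurable_funB.
have k0 (a t : R) : 0 <= cauchy_kernel N (a - t) by exact: cauchy_kernel_ge0.
have := ge0_integral_tensor3 (mk x.1.1) (mk x.1.2) (mk x.2) (k0 _) (k0 _) (k0 _).
rewrite !integral_cauchy_kernel// => h; apply: (etrans h).
by rewrite -!EFinM; congr EFin; ring.
Qed.

(** By the addition formula the kernel is the transform of the weight at [y - x], a product of three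
    one-dimensional transforms. The product of their Cauchy majorants has row integral
    [(8 * pi) ^ 3] for every [N]. *)
Lemma weighted_plancherel N (f : pt3 R -> R) : 0 < N ->
  mu3.-integrable setT (EFin \o f) ->
  (\int[mu3]_xi (welch3 N xi * (Rintegral mu3 setT (fun y => f y * cos (dot3 xi y)) ^+ 2 +
                               Rintegral mu3 setT (fun y => f y * sin (dot3 xi y)) ^+ 2))%:E
   <= ((8 * pi) ^+ 3)%:E * \int[mu3]_y (f y ^+ 2)%:E)%E.
Proof.
move=> N0 intf.
have mcos := measurable_cos_dot3; have msin := measurable_sin_dot3.
have mH : measurable_fun setT (fun z : pt3 R * pt3 R => cauchy3 N (sub3 z.1 z.2)).
  have mk := measurable_cauchy_kernel N.
  apply: measurable_funM; first apply: measurable_funM.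
  - apply: (measurableT_comp mk); apply: measurable_funB.
      exact: (measurableT_comp measurable_pt3_coord1 measurable_fst).
    exact: (measurableT_comp measurable_pt3_coord1 measurable_snd).
  - apply: (measurableT_comp mk); apply: measurable_funB.
      exact: (measurableT_comp measurable_pt3_coord2 measurable_fst).
    exact: (measurableT_comp measurable_pt3_coord2 measurable_snd).
  - apply: (measurableT_comp mk); apply: measurable_funB.
      exact: (measurableT_comp measurable_pt3_coord3 measurable_fst).
    exact: (measurableT_comp measurable_pt3_coord3 measurable_snd).
apply: (@fourier_schur_bound _ _ _ _ _ mu3 mu3 (welch3 N) f
  (fun z => cos (dot3 z.1 z.2)) (fun z => sin (dot3 z.1 z.2))
  (fun z => cauchy3 N (sub3 z.1 z.2))) => //.
- by rewrite exprn_ge0// mulr_ge0// pi_ge0.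
- by move=> xi; exact: welch3_ge0.
- by apply: integrable_tensor3; exact: integrable_welch.
- by move=> z; exact: cos_max.
- by move=> z; exact: sin_max.
- by move=> z; apply: mulr_ge0; [apply: mulr_ge0|]; exact: cauchy_kernel_ge0.
- move=> x y; rewrite /cauchy3 /cauchy_kernel /sub3 /=.
  by congr (_ * _ * _); congr (_ / (_ + _ * _)); ring.
- by move=> y; rewrite integral_cauchy3.
- move=> y x.
  under eq_Rintegral => xi _.
    rewrite /= (_ : _ + _ = cos (dot3 xi (sub3 y x))); last first.
      rewrite -cosB -cosN /dot3 /sub3 /=; congr cos; ring.
    over.
  rewrite Rintegral_welch3_cos// !normrM.
  apply: ler_pM; rewrite ?mulr_ge0 ?welch_ft_le//.
  by apply: ler_pM; rewrite ?welch_ft_le.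
Qed.

Lemma cvg_welch3 x : welch3 n.+1%:R x @[n --> \oo] --> (1 : R).
Proof.
have h := cvgM (cvgM (cvg_welch x.1.1) (cvg_welch x.1.2)) (cvg_welch x.2).
by rewrite !mulr1 in h; exact: h.
Qed.

Lemma welch3_nondecreasing N N' x : 0 < N -> N <= N' -> welch3 N x <= welch3 N' x.
Proof.
move=> N0 NN'; apply: ler_pM; rewrite ?mulr_ge0 ?welch_ge0 ?welch_nondecreasing//.
by apply: ler_pM; rewrite ?mulr_ge0 ?welch_ge0 ?welch_nondecreasing.
Qed.

Lemma measurable_welch3 N : measurable_fun setT (welch3 N).
Proof. by apply: measurable_tensor3; exact: measurable_welch. Qed.

(** Monotone convergence along [N = n + 1]: the weights increase to 1 and the right-hand side is
    uniform in [N]. The constant exceeds the sharp [(2 * pi) ^ 3], at the cost of a larger final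
    constant only. *)
Lemma plancherel_le (f : pt3 R -> R) :
  mu3.-integrable setT (EFin \o f) ->
  (\int[mu3]_xi (Rintegral mu3 setT (fun y => f y * cos (dot3 xi y)) ^+ 2 +
                 Rintegral mu3 setT (fun y => f y * sin (dot3 xi y)) ^+ 2)%:E
   <= ((8 * pi) ^+ 3)%:E * \int[mu3]_y (f y ^+ 2)%:E)%E.
Proof.
move=> intf.
pose P xi := Rintegral mu3 setT (fun y => f y * cos (dot3 xi y)) ^+ 2 +
             Rintegral mu3 setT (fun y => f y * sin (dot3 xi y)) ^+ 2.
rewrite -/(integral mu3 setT (fun xi => (P xi)%:E)).
have P0 xi : 0 <= P xi by rewrite addr_ge0 ?sqr_ge0.
have mf : measurable_fun setT f by apply/measurable_EFinP; exact: measurable_int intf.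
have mP : measurable_fun setT P.
  apply: measurable_funD; apply: measurable_funX.
    exact: (measurable_Rintegral_param mu3 mf measurable_cos_dot3).
  exact: (measurable_Rintegral_param mu3 mf measurable_sin_dot3).
have lim_eq xi : limn (fun n => (welch3 n.+1%:R xi * P xi)%:E) = (P xi)%:E.
  have h : (fun n : nat => welch3 n.+1%:R xi * P xi) @ \oo --> 1 * P xi.
    by apply: cvgM; [exact: cvg_welch3|exact: cvg_cst].
  rewrite mul1r in h; apply/cvg_lim => //.
  by apply/fine_cvgP; split; [exact: nearW|exact: h].
under eq_integral => xi _ do rewrite -lim_eq.
rewrite monotone_convergence//=; last 3 first.
- move=> n; apply/measurable_EFinP; apply: measurable_funM => //; exact: measurable_welch3.
- by move=> n xi _; rewrite lee_fin mulr_ge0// welch3_ge0.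
- move=> xi _ n k nk; rewrite lee_fin; apply: ler_wpM2r => //.
  by apply: welch3_nondecreasing => //; rewrite ler_nat ltnS.
apply: lime_le.
  apply: ereal_nondecreasing_is_cvgn => n k nk; apply: ge0_le_integral => //.
  - by move=> xi _; rewrite lee_fin mulr_ge0// welch3_ge0.
  - apply/measurable_EFinP; apply: measurable_funM => //; exact: measurable_welch3.
  - apply/measurable_EFinP; apply: measurable_funM => //; exact: measurable_welch3.
  - move=> xi _; rewrite lee_fin; apply: ler_wpM2r => //.
    by apply: welch3_nondecreasing => //; rewrite ler_nat ltnS.
by near=> n; exact: weighted_plancherel.
Unshelve. all: by end_near. Qed.
End leb3_integrals.

(** * Euclidean geometry and the cone of observed frequencies *)

Section geometry.
Variable R : realType.
Implicit Types (x y q : pt3 R) (k : R).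

Definition add3 x y : pt3 R := ((x.1.1 + y.1.1, x.1.2 + y.1.2), x.2 + y.2).

Lemma pt3_eq x y : x.1.1 = y.1.1 -> x.1.2 = y.1.2 -> x.2 = y.2 -> x = y.
Proof. by case: x y => [[a b] c] [[a' b'] c'] /= -> -> ->. Qed.

Lemma dot3_ge0 x : 0 <= dot3 x x.
Proof. by rewrite /dot3 -!expr2 !addr_ge0 ?sqr_ge0. Qed.

Lemma norm3_ge0 x : 0 <= norm3 x.
Proof. exact: sqrtr_ge0. Qed.

Lemma norm3_sqr x : norm3 x ^+ 2 = dot3 x x.
Proof. by rewrite sqr_sqrtr// dot3_ge0. Qed.

(** Cauchy-Schwarz through Lagrange's identity: the defect is a sum of three squares. *)
Lemma normr_dot3_le x y : `|dot3 x y| <= norm3 x * norm3 y.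
Proof.
rewrite -(ger0_norm (mulr_ge0 (norm3_ge0 x) (norm3_ge0 y))) -ler_sqr ?nnegrE//.
rewrite !real_normK ?num_real// exprMn !norm3_sqr -subr_ge0 /dot3.
set a := x.1.1; set b := x.1.2; set c := x.2; set a' := y.1.1; set b' := y.1.2; set c' := y.2.
have -> : (a * a + b * b + c * c) * (a' * a' + b' * b' + c' * c')
   - (a * a' + b * b' + c * c') ^+ 2 =
   (a * b' - b * a') ^+ 2 + (a * c' - c * a') ^+ 2 + (b * c' - c * b') ^+ 2 by ring.
by rewrite !addr_ge0 ?sqr_ge0.
Qed.

Lemma norm3_add_le x y : norm3 (add3 x y) <= norm3 x + norm3 y.
Proof.
have h := normr_dot3_le x y.
rewrite -ler_sqr ?nnegrE ?addr_ge0 ?norm3_ge0// sqrrD !norm3_sqr.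
have -> : dot3 (add3 x y) (add3 x y) = dot3 x x + dot3 x y *+ 2 + dot3 y y.
  by rewrite /dot3 /add3 /=; ring.
by rewrite lerD2r lerD2l lerMn2r /= (le_trans (ler_norm _)).
Qed.

Lemma norm3_scale k x : norm3 (scale3 k x) = `|k| * norm3 x.
Proof.
apply/eqP; rewrite -(@eqrXn2 _ 2)// ?mulr_ge0 ?norm3_ge0//.
rewrite exprMn real_normK ?num_real// !norm3_sqr /dot3 /scale3 /=.
by apply/eqP; ring.
Qed.

Lemma coord_le_norm3 x : [/\ `|x.1.1| <= norm3 x, `|x.1.2| <= norm3 x & `|x.2| <= norm3 x].
Proof.
by split; rewrite -ler_sqr ?nnegrE ?norm3_ge0// norm3_sqr real_normK ?num_real// /dot3
  -!expr2 ?lerDr ?addr_ge0 ?sqr_ge0// -?addrA ?lerDl ?addr_ge0 ?sqr_ge0// addrCA lerDl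
  addr_ge0 ?sqr_ge0.
Qed.

(** With [r] the distance from [q] to [s x0], the length of [q] lies between [3 s / 4] and
    [5 s / 4], hence below [K]. Its direction differs from [x0] by at most [2 r / |q|], which is at
    most [8 eta / 3] and so less than [delta]. *)
Lemma near_axis_in_cap (x0 q : pt3 R) (delta K s eta : R) :
  norm3 x0 = 1 -> 0 < s -> s <= K / 2 -> 0 < eta -> eta <= 1 / 4 -> eta <= delta / 4 ->
  norm3 (sub3 q (scale3 s x0)) <= eta * s ->
  exists xhat, cap_times_interval x0 delta K (xhat, norm3 q) /\ scale3 (norm3 q) xhat = q.
Proof.
move=> x01 s0 sK e0 e1 ed hq.
set p := scale3 s x0 in hq *; set r := norm3 (sub3 q p) in hq *.
have np : norm3 p = s by rewrite norm3_scale x01 mulr1 gtr0_norm.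
have h1 : norm3 q <= r + s.
  rewrite -np (le_trans _ (norm3_add_le _ _))//.
  by rewrite (_ : add3 _ _ = q)//; apply: pt3_eq; rewrite /add3 /sub3 /= subrK.
have h2 : s <= r + norm3 q.
  rewrite -{1}np (le_trans _ (lerD (_ : norm3 (scale3 (-1) (sub3 q p)) <= r) (lexx _)))//.
    rewrite (le_trans _ (norm3_add_le _ _))//.
    by rewrite (_ : add3 _ _ = p)//; apply: pt3_eq; rewrite /add3 /sub3 /=; ring.
  by rewrite norm3_scale normrN1 mul1r.
have r0 : 0 <= r by exact: norm3_ge0.
have q0 : 0 < norm3 q by nra.
exists (scale3 (norm3 q)^-1 q); split; last first.
  by apply: pt3_eq; rewrite /scale3 /= mulrA divff ?mul1r// gt_eqF.
split => /=; first by rewrite norm3_scale ger0_norm ?invr_ge0 ?norm3_ge0// mulVf// gt_eqF.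
split; last by rewrite q0 /=; nra.
have -> : sub3 (scale3 (norm3 q)^-1 q) x0 =
    scale3 (norm3 q)^-1 (add3 (sub3 q p) (scale3 (s - norm3 q) x0)).
  by apply: pt3_eq; rewrite /sub3 /add3 /p /scale3 /=; field; rewrite gt_eqF.
rewrite norm3_scale ger0_norm ?invr_ge0 ?norm3_ge0// mulrC ltr_pdivrMr//.
apply: (le_lt_trans (norm3_add_le _ _)); rewrite norm3_scale x01 mulr1 -/r.
have h3 : `|s - norm3 q| <= r by rewrite ler_norml; apply/andP; split; lra.
nra.
Qed.
End geometry.

(** * Integrability of a compactly supported square-integrable source *)

Section source.
Variable R : realType.
Let mu := @lebesgue_measure R.
Let mu3 := @leb3 R.
Variables (Rad : R) (fr fi : pt3 R -> R).
Hypothesis hRad : 0 < Rad.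
Hypotheses (mfr : measurable_fun setT fr) (mfi : measurable_fun setT fi).
Hypothesis hL2 : (L2_norm2 fr fi < +oo)%E.
Hypothesis hsupp : forall y, Rad <= norm3 y -> fr y = 0 /\ fi y = 0.

(** A cube stands in for the ball it encloses: its indicator is a tensor product, so its integral
    factorises. *)
Definition box_indic (r : R) : pt3 R -> R :=
  let I := \1_(`[- r, r] : set R) in tensor3 I I I.

Lemma measurable_box_indic r : measurable_fun setT (box_indic r).
Proof. by apply: measurable_tensor3; exact: measurable_indic. Qed.

Lemma box_indic_ge0 r y : 0 <= box_indic r y.
Proof. by rewrite /box_indic /tensor3 !mulr_ge0 ?indicE. Qed.

Lemma box_indic_eq1 r y : norm3 y <= r -> box_indic r y = 1.
Proof.
have [h1 h2 h3] := coord_le_norm3 y => yr.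
rewrite /box_indic /tensor3 !indicE !mem_set ?mulr1//= in_itv /= -ler_norml;
  exact: le_trans yr.
Qed.

Lemma integral_box_indic r : 0 < r -> (\int[mu3]_y (box_indic r y)%:E = ((2 * r) ^+ 3)%:E)%E.
Proof.
move=> r0; rewrite ge0_integral_tensor3; try exact: measurable_indic; try by move=> t; rewrite indicE.
have -> : (\int[mu]_t (\1_(`[- r, r] : set R) t)%:E = (2 * r)%:E)%E.
  rewrite integral_indic// setIT; apply: (etrans (lebesgue_measure_itv `[- r, r])).
  by rewrite /= lte_fin gtrN// -EFinD; congr EFin; ring.
by rewrite -!EFinM; congr EFin; ring.
Qed.

Let S y := fr y ^+ 2 + fi y ^+ 2.
Let S0 y : 0 <= S y. Proof. by rewrite addr_ge0 ?sqr_ge0. Qed.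
Let mS : measurable_fun setT S.
Proof. by apply: measurable_funD; exact: measurable_funX. Qed.

Definition L2n := Num.sqrt (fine (L2_norm2 fr fi)).

Lemma L2n_sqr : ((L2n ^+ 2)%:E = L2_norm2 fr fi)%E.
Proof.
have h : (0 <= L2_norm2 fr fi)%E.
  by apply: integral_ge0 => y _; rewrite lee_fin; exact: S0.
rewrite /L2n sqr_sqrtr ?fine_ge0// fineK// ge0_fin_numE//.
Qed.

Let A y := `|fr y| + `|fi y|.
Let mA : measurable_fun setT A.
Proof. by apply: measurable_funD; exact: measurableT_comp. Qed.

(** Cauchy-Schwarz in parametric form: on the support each of [|fr|] and [|fi|] is at most [l / 2]
    plus its square over [2 * l]. *)
Let L1_param (l : R) : 0 < l ->
  (\int[mu3]_y (A y)%:E <= (l * (2 * Rad) ^+ 3 + (2 * l)^-1 * L2n ^+ 2)%:E)%E.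
Proof.
move=> l0.
have l2 : 0 <= (2 * l)^-1 by rewrite invr_ge0 mulr_ge0// ltW.
apply: (@le_trans _ _ (\int[mu3]_y (l%:E * (box_indic Rad y)%:E + (2 * l)^-1%:E * (S y)%:E))%E).
  apply: ge0_le_integral => //.
  - by move=> y _; rewrite lee_fin addr_ge0.
  - exact/measurable_EFinP.
  - apply: emeasurable_funD; apply: emeasurable_funM => //; apply/measurable_EFinP => //.
    exact: measurable_box_indic.
  - move=> y _; rewrite -!EFinM -EFinD lee_fin /A /S.
    have [h|h] := leP Rad (norm3 y).
      have [-> ->] := hsupp h; rewrite normr0 expr0n /= !addr0 mulr0 addr0.
      by rewrite mulr_ge0 ?(ltW l0) ?box_indic_ge0.
    rewrite (box_indic_eq1 (ltW h)) mulr1.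
    rewrite -[fr y ^+ 2]real_normK ?num_real// -[fi y ^+ 2]real_normK ?num_real//.
    set u := `|fr y|; set v := `|fi y|.
    have -> : l + (2 * l)^-1 * (u ^+ 2 + v ^+ 2) =
      u + v + (2 * l)^-1 * ((l - u) ^+ 2 + (l - v) ^+ 2) by field; rewrite gt_eqF.
    by rewrite lerDl mulr_ge0// addr_ge0 ?sqr_ge0.
rewrite ge0_integralD//; last 4 first.
- by move=> y _; rewrite -EFinM lee_fin mulr_ge0 ?(ltW l0) ?box_indic_ge0.
- by apply: emeasurable_funM => //; apply/measurable_EFinP; exact: measurable_box_indic.
- by move=> y _; rewrite -EFinM lee_fin mulr_ge0.
- by apply: emeasurable_funM => //; apply/measurable_EFinP.
have -> : (\int[mu3]_y (l%:E * (box_indic Rad y)%:E) = l%:E * \int[mu3]_y (box_indic Rad y)%:E)%E.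
  rewrite ge0_integralZl//.
  - by apply/measurable_EFinP; exact: measurable_box_indic.
  - by move=> y _; rewrite lee_fin box_indic_ge0.
  - by rewrite lee_fin ltW.
have -> : (\int[mu3]_y ((2 * l)^-1%:E * (S y)%:E) = (2 * l)^-1%:E * \int[mu3]_y (S y)%:E)%E.
  rewrite ge0_integralZl//; first exact/measurable_EFinP.
  by move=> y _; rewrite lee_fin.
by rewrite integral_box_indic// -/(L2_norm2 fr fi) -L2n_sqr -!EFinM -EFinD.
Qed.

(** The parameter is taken equal to [L2n]. If that is zero, arbitrarily small parameters show that
    the integral vanishes. *)
Lemma L1_le_L2 : (\int[mu3]_y (A y)%:E <= (((2 * Rad) ^+ 3 + 1) * L2n)%:E)%E.
Proof.
have n0 : 0 <= L2n by exact: sqrtr_ge0.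
have [L0|] := ltP 0 L2n.
  apply: (le_trans (L1_param L0)); rewrite lee_fin.
  have -> : (2 * L2n)^-1 * L2n ^+ 2 = L2n / 2 by field; rewrite gt_eqF.
  by lra.
move=> L0; have -> : L2n = 0 by apply/eqP; rewrite eq_le L0 n0.
rewrite mulr0; apply/lee_addgt0Pr => e e0; rewrite add0e.
have v0 : 0 < (2 * Rad) ^+ 3 by rewrite exprn_gt0// mulr_gt0.
have := L1_param (divr_gt0 e0 v0).
have -> : L2n = 0 by apply/eqP; rewrite eq_le L0 n0.
by rewrite expr0n /= mulr0 addr0 divfK ?gt_eqF.
Qed.

Lemma integrable_source : mu3.-integrable setT (EFin \o fr) /\ mu3.-integrable setT (EFin \o fi).
Proof.
have iA : mu3.-integrable setT (EFin \o A).
  apply/integrableP; split; first exact/measurable_EFinP.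
  under eq_integral => y _ do rewrite /= ger0_norm ?addr_ge0//.
  by apply: (le_lt_trans L1_le_L2); rewrite ltry.
split; apply: (le_integrable _ _ _ iA) => //; try exact/measurable_EFinP.
- by move=> y _; rewrite /= lee_fin [leRHS]ger0_norm ?addr_ge0// lerDl.
- by move=> y _; rewrite /= lee_fin [leRHS]ger0_norm ?addr_ge0// lerDr.
Qed.
End source.

(** * The Fourier transform of a complex source: square bound and extrapolation *)

Section fourier_transform.
Variable R : realType.
Let mu3 := @leb3 R.
Variables fr fi : pt3 R -> R.
Hypotheses (ifr : mu3.-integrable setT (EFin \o fr)) (ifi : mu3.-integrable setT (EFin \o fi)).

Let mfr : measurable_fun setT fr.
Proof. by apply/measurable_EFinP; exact: measurable_int ifr. Qed.
Let mfi : measurable_fun setT fi.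
Proof. by apply/measurable_EFinP; exact: measurable_int ifi. Qed.

Let mc (xi : pt3 R) : measurable_fun setT (fun y => cos (dot3 xi y)).
Proof. exact: (measurableT_comp (@measurable_cos_dot3 R) (pair1_measurable xi)). Qed.
Let ms (xi : pt3 R) : measurable_fun setT (fun y => sin (dot3 xi y)).
Proof. exact: (measurableT_comp (@measurable_sin_dot3 R) (pair1_measurable xi)). Qed.

Let ic (f : pt3 R -> R) xi : mu3.-integrable setT (EFin \o f) ->
  mu3.-integrable setT (fun y => (f y * cos (dot3 xi y))%:E).
Proof. by move=> h; apply: (integrable_mul_bounded h (mc xi)) => y; exact: cos_max. Qed.
Let is_ (f : pt3 R -> R) xi : mu3.-integrable setT (EFin \o f) ->
  mu3.-integrable setT (fun y => (f y * sin (dot3 xi y))%:E).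
Proof. by move=> h; apply: (integrable_mul_bounded h (ms xi)) => y; exact: sin_max. Qed.

Let C (f : pt3 R -> R) xi := Rintegral mu3 setT (fun y => f y * cos (dot3 xi y)).
Let S (f : pt3 R -> R) xi := Rintegral mu3 setT (fun y => f y * sin (dot3 xi y)).

Let ftReE xi : ftRe fr fi xi = C fr xi + S fi xi.
Proof. by rewrite /ftRe RintegralD//; [exact: ic|exact: is_]. Qed.

Let ftImE xi : ftIm fr fi xi = C fi xi - S fr xi.
Proof. by rewrite /ftIm RintegralB//; [exact: ic|exact: is_]. Qed.

Let mC f : measurable_fun setT f -> measurable_fun setT (C f).
Proof. by move=> mf; exact: (measurable_Rintegral_param mu3 mf (@measurable_cos_dot3 R)). Qed.
Let mS f : measurable_fun setT f -> measurable_fun setT (S f).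
Proof. by move=> mf; exact: (measurable_Rintegral_param mu3 mf (@measurable_sin_dot3 R)). Qed.

Lemma measurable_ft_abs2 : measurable_fun setT (fun xi => ftRe fr fi xi ^+ 2 + ftIm fr fi xi ^+ 2).
Proof.
under eq_fun do rewrite ftReE ftImE.
apply: measurable_funD; apply: measurable_funX.
  by apply: measurable_funD; [exact: mC|exact: mS].
by apply: measurable_funB; [exact: mC|exact: mS].
Qed.

(** The cosine and sine transforms of [fr] and [fi] mix in the real and imaginary parts; the square
    of a sum is at most twice the sum of squares, whence the factor 2. *)
Lemma ft_L2_le :
  (\int[mu3]_xi (ftRe fr fi xi ^+ 2 + ftIm fr fi xi ^+ 2)%:E <=
   (2 * (8 * pi) ^+ 3)%:E * L2_norm2 fr fi)%E.
Proof.
pose P f xi := C f xi ^+ 2 + S f xi ^+ 2.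
have P0 f xi : 0 <= P f xi by rewrite addr_ge0 ?sqr_ge0.
have mP (f : pt3 R -> R) : measurable_fun setT f -> measurable_fun setT (P f).
  by move=> mf; apply: measurable_funD; apply: measurable_funX; [exact: mC|exact: mS].
have ms2 (f : pt3 R -> R) : measurable_fun setT f -> measurable_fun setT (fun y => (f y ^+ 2)%:E).
  by move=> mf; apply/measurable_EFinP; exact: measurable_funX.
apply: (@le_trans _ _ (\int[mu3]_xi (2%:E * ((P fr xi)%:E + (P fi xi)%:E)))%E).
  apply: ge0_le_integral => //.
  - by move=> xi _; rewrite lee_fin addr_ge0 ?sqr_ge0.
  - by apply/measurable_EFinP; exact: measurable_ft_abs2.
  - apply: emeasurable_funM => //; apply: emeasurable_funD; apply/measurable_EFinP; exact: mP.
  - move=> xi _; rewrite -EFinD -EFinM lee_fin ftReE ftImE /P.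
    set a := C fr xi; set b := S fr xi; set c := C fi xi; set d := S fi xi.
    have := sqr_ge0 (a - d); have := sqr_ge0 (c + b); nra.
rewrite ge0_integralZl//; last 2 first.
- by apply: emeasurable_funD; apply/measurable_EFinP; exact: mP.
- by move=> xi _; rewrite -EFinD lee_fin addr_ge0.
rewrite ge0_integralD//; last 4 first.
- by move=> xi _; rewrite lee_fin.
- by apply/measurable_EFinP; exact: mP.
- by move=> xi _; rewrite lee_fin.
- by apply/measurable_EFinP; exact: mP.
rewrite /L2_norm2; under [X in (_ <= _ * X)%E]eq_integral => y _ do rewrite EFinD.
rewrite [X in (_ <= _ * X)%E]ge0_integralD//; last 4 first.
- by move=> y _; rewrite lee_fin sqr_ge0.
- exact: ms2.
- by move=> y _; rewrite lee_fin sqr_ge0.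
- exact: ms2.
rewrite EFinM -muleA; apply: lee_wpmul2l; first by rewrite lee_fin.
rewrite ge0_muleDr; try by apply: integral_ge0 => y _; rewrite lee_fin sqr_ge0.
by apply: leeD; exact: plancherel_le.
Qed.

Lemma ftRe_abs_le (M : R) xi :
  (\int[mu3]_y (`|fr y| + `|fi y|)%:E <= M%:E)%E -> `|ftRe fr fi xi| <= M.
Proof.
move=> hM; rewrite /ftRe -lee_fin; apply: le_trans hM.
have mi : measurable_fun setT (fun y => fr y * cos (dot3 xi y) + fi y * sin (dot3 xi y)).
  by apply: measurable_funD; apply: measurable_funM.
apply: (le_trans (normr_Rintegral_le mu3 mi)); apply: ge0_le_integral => //.
- by apply/measurable_EFinP; exact: measurableT_comp.
- by apply/measurable_EFinP; apply: measurable_funD; exact: measurableT_comp.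
- move=> y _; rewrite lee_fin (le_trans (ler_normD _ _))// !normrM.
  by apply: lerD; rewrite ler_piMr ?cos_max ?sin_max.
Qed.

Lemma iter_fdiff_Rintegral d (T : measurableType d) (m : {measure set T -> \bar R})
    (h : nat -> T -> R) : (forall j, m.-integrable setT (EFin \o h j)) ->
  forall k j, m.-integrable setT (fun y : T => (iter k (@fdiff R) (fun i => h i y) j)%:E) /\
    iter k (@fdiff R) (fun j => Rintegral m setT (h j)) j =
    Rintegral m setT (fun y : T => iter k (@fdiff R) (fun i => h i y) j).
Proof.
move=> hh; elim=> [|k IH] j /=; first by split => //; exact: hh.
have [i1 e1] := IH j.+1; have [i0 e0] := IH j.
split; first exact: (integrableB measurableT i1 i0).
by rewrite /fdiff e1 e0 RintegralB.
Qed.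

Definition segment3 (p xi : pt3 R) (t : R) := add3 p (scale3 t (sub3 xi p)).

(** At equidistant nodes of the segment the phase is affine in the index, with slope [b y] of size
    at most [D * Rad / m] on the support. Differences commute with the integral, so
    [newton_extrapolation] applies with [X = D * Rad]. *)
Lemma ftRe_extrapolation (Rad M D eps : R) (p xi : pt3 R) (n m : nat) :
  (forall y, Rad <= norm3 y -> fr y = 0 /\ fi y = 0) ->
  (\int[mu3]_y (`|fr y| + `|fi y|)%:E <= M%:E)%E ->
  0 <= Rad -> 0 <= M -> 0 <= D -> 0 <= eps -> norm3 (sub3 xi p) <= D ->
  (0 < n <= m)%N ->
  (forall j, (j <= n)%N -> `|ftRe fr fi (segment3 p xi (j%:R / m%:R))| <= eps) ->
  `|ftRe fr fi xi| <= eps * ((m%:R / n%:R) ^+ n * expR (2 * n%:R)) +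
                      M * expR (4 * (D * Rad) - n%:R).
Proof.
move=> hsupp hM R0 M0 D0 e0 hD nm hnodes.
have m0 : 0 < m%:R :> R by rewrite ltr0n; lia.
have seg1 : segment3 p xi (m%:R / m%:R) = xi.
  by rewrite divff ?gt_eqF//; apply: pt3_eq; rewrite /segment3 /add3 /scale3 /sub3 /=; ring.
rewrite -{1}seg1.
pose b y := dot3 (sub3 xi p) y / m%:R.
have segE y j : dot3 (segment3 p xi (j%:R / m%:R)) y = dot3 p y + j%:R * b y.
  by rewrite /segment3 /b /dot3 /add3 /scale3 /sub3 /=; field; rewrite gt_eqF.
pose h j y := fr y * cos (dot3 (segment3 p xi (j%:R / m%:R)) y) +
              fi y * sin (dot3 (segment3 p xi (j%:R / m%:R)) y).
have ih j : mu3.-integrable setT (EFin \o h j).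
  by apply: (integrableD measurableT (ic _ ifr) (is_ _ ifi)).
apply: (newton_extrapolation (g := fun j => ftRe fr fi (segment3 p xi (j%:R / m%:R)))) => //.
  exact: mulr_ge0.
move=> k; have [ik ->] := iter_fdiff_Rintegral ih k 0.
have mi : measurable_fun setT (fun y => iter k (@fdiff R) (fun i => h i y) 0).
  by apply/measurable_EFinP; exact: measurable_int ik.
rewrite -lee_fin; apply: (le_trans (normr_Rintegral_le mu3 mi)).
have c0 : 0 <= (D * Rad / m%:R) ^+ k by rewrite exprn_ge0// divr_ge0 ?mulr_ge0// ltW.
have mA : measurable_fun setT (fun y => (`|fr y| + `|fi y|)%:E).
  by apply/measurable_EFinP; apply: measurable_funD; exact: measurableT_comp.
apply: (@le_trans _ _ (\int[mu3]_y (((D * Rad / m%:R) ^+ k)%:E * (`|fr y| + `|fi y|)%:E))%E).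
  apply: ge0_le_integral => //.
  - by apply/measurable_EFinP; exact: measurableT_comp.
  - exact: emeasurable_funM.
  - move=> y _; rewrite -EFinM lee_fin.
    have -> : (fun i => h i y) = (fun j => fr y * cos (dot3 p y + j%:R * b y) +
                                 fi y * sin (dot3 p y + j%:R * b y)).
      by apply/funext => j; rewrite /h segE.
    rewrite iter_fdiff_lin (le_trans (ler_normD _ _))// !normrM.
    have [hy|hy] := leP Rad (norm3 y).
      by have [-> ->] := hsupp y hy; rewrite normr0 !mul0r addr0 mulr0.
    have hb : `|b y| <= D * Rad / m%:R.
      rewrite /b normrM normfV (gtr0_norm m0) ler_pM2r ?invr_gt0//.
      apply: (le_trans (normr_dot3_le _ _)).
      by apply: ler_pM => //; rewrite ?norm3_ge0// ltW.
    have hbk : `|b y| ^+ k <= (D * Rad / m%:R) ^+ k.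
      by apply: lerXn2r => //; rewrite nnegrE// divr_ge0 ?mulr_ge0// ltW.
    rewrite mulrDr ![_ ^+ k * _]mulrC; apply: lerD; apply: ler_wpM2l => //.
      exact: le_trans (iter_fdiff_cos_le _ _ _ _) hbk.
    exact: le_trans (iter_fdiff_sin_le _ _ _ _) hbk.
rewrite ge0_integralZl//.
by rewrite [M * _]mulrC EFinM; apply: lee_wpmul2l.
Qed.
End fourier_transform.

(** * Continuation of the far-field data to low frequencies *)

Section low_frequencies.
Variable R : realType.
Let mu3 := @leb3 R.
Variables (Rad delta K M : R) (x0 : pt3 R) (fr fi : pt3 R -> R).
Hypotheses (hRad : 0 <= Rad) (hdelta : 0 < delta) (hK : 0 < K) (hx0 : norm3 x0 = 1) (hM0 : 0 <= M).
Hypotheses (ifr : mu3.-integrable setT (EFin \o fr)) (ifi : mu3.-integrable setT (EFin \o fi)).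
Hypothesis hsupp : forall y, Rad <= norm3 y -> fr y = 0 /\ fi y = 0.
Hypothesis hM : (\int[mu3]_y (`|fr y| + `|fi y|)%:E <= M%:E)%E.
Let eps := farfield_sup fr fi x0 delta K.

(** Multiplying the source by [-i] turns the imaginary part into a real part, so bounds on [ftRe]
    suffice. *)
Let ftImE xi : ftIm fr fi xi = ftRe fi (fun y => - fr y) xi.
Proof. by rewrite /ftIm /ftRe; apply: eq_Rintegral => y _; rewrite mulNr. Qed.

Let ifrN : mu3.-integrable setT (EFin \o (fun y => - fr y)).
Proof. exact: (integrableN ifr). Qed.

Let hMN : (\int[mu3]_y (`|fi y| + `|- fr y|)%:E <= M%:E)%E.
Proof. by under eq_integral => y _ do rewrite normrN addrC. Qed.

(** [sup] is a least upper bound only for a nonempty set that is bounded above. The point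
    [(x0, K / 2)] gives the former, the integral bound [M] the latter. *)
Let farfield_has_sup :
  has_sup [set farfield_abs fr fi p.1 p.2 | p in cap_times_interval x0 delta K].
Proof.
split.
  exists (farfield_abs fr fi x0 (K / 2)), (x0, K / 2) => //; split => //=; split; last first.
    by rewrite divr_gt0//= ltr_pdivrMr// mulr_natr mulr2n ltrDl.
  rewrite (_ : sub3 x0 x0 = scale3 0 x0); first by rewrite norm3_scale normr0 mul0r.
  by apply: pt3_eq; rewrite /= subrr mul0r.
exists (M + M) => _ [p _ <-]; rewrite /farfield_abs.
have h1 := ftRe_abs_le ifr ifi (scale3 p.2 p.1) hM.
have h2 := ftRe_abs_le ifi ifrN (scale3 p.2 p.1) hMN; rewrite -ftImE in h2.
rewrite -(ger0_norm (addr_ge0 hM0 hM0)) -sqrtr_sqr; apply: ler_wsqrtr.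
rewrite -[ftRe _ _ _ ^+ 2]real_normK ?num_real// -[ftIm _ _ _ ^+ 2]real_normK ?num_real//.
have := normr_ge0 (ftRe fr fi (scale3 p.2 p.1)); have := normr_ge0 (ftIm fr fi (scale3 p.2 p.1)).
by nra.
Qed.

Lemma farfield_sup_ge0 : 0 <= eps.
Proof.
have [[_ [p hp _]] hub] := farfield_has_sup.
apply: (@le_trans _ _ (farfield_abs fr fi p.1 p.2)); first exact: sqrtr_ge0.
by apply: ub_le_sup => //; exists p.
Qed.

Let cap_le xhat k : cap_times_interval x0 delta K (xhat, k) ->
  `|ftRe fr fi (scale3 k xhat)| <= eps /\ `|ftIm fr fi (scale3 k xhat)| <= eps.
Proof.
move=> hp; have [_ hub] := farfield_has_sup.
have h : farfield_abs fr fi xhat k <= eps by apply: ub_le_sup => //; exists (xhat, k).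
by split; apply: le_trans h; rewrite -sqrtr_sqr; apply: ler_wsqrtr;
  rewrite ?lerDl ?lerDr sqr_ge0.
Qed.

Definition aperture := Num.min (1 / 4) (delta / 4).

Lemma aperture_gt0 : 0 < aperture.
Proof. by rewrite lt_min !divr_gt0. Qed.

(** The order [n] is left free: it is taken proportional to [rho] for positive data and arbitrarily
    large for zero data. *)
Lemma ft_low_frequency (rho : R) (n : nat) (xi : pt3 R) :
  0 < rho -> (0 < n)%N -> norm3 xi <= rho ->
  let B := eps * expR (n%:R * (2 + 2 / aperture * (1 + 2 * rho / K))) +
           M * expR (8 * rho * Rad - n%:R) in
  `|ftRe fr fi xi| <= B /\ `|ftIm fr fi xi| <= B.
Proof.
move=> rho0 n0 hxi B.
have eta0 := aperture_gt0.
have [eta1 etad] : aperture <= 1 / 4 /\ aperture <= delta / 4.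
  by rewrite /aperture !ge_min !lexx orbT.
set eta := aperture in eta0 eta1 etad B *.
(* The bound [K / 2] keeps the nodes near [s x0] below frequency [K]; the bound [rho] keeps the
   segment to [xi] of length at most [2 * rho]. *)
pose s := Num.min (K / 2) rho.
have s0 : 0 < s by rewrite lt_min rho0 divr_gt0.
have sK : s <= K / 2 by rewrite ge_min lexx.
have sr : s <= rho by rewrite ge_min lexx orbT.
have rs : rho / s <= 1 + 2 * rho / K.
  rewrite ler_pdivrMr// /s; have [h|h] := leP (K / 2) rho.
    have -> : (1 + 2 * rho / K) * (K / 2) = rho + K / 2 by field; rewrite gt_eqF.
    by rewrite lerDl divr_ge0// ltW.
  by rewrite ler_peMl ?(ltW rho0)// lerDl divr_ge0 ?mulr_ge0// ltW.
pose p := scale3 s x0.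
have hD : norm3 (sub3 xi p) <= 2 * rho.
  rewrite (_ : sub3 xi p = add3 xi (scale3 (- s) x0)); last first.
    by apply: pt3_eq; rewrite /p /= mulNr.
  apply: (le_trans (norm3_add_le _ _)).
  by rewrite norm3_scale hx0 mulr1 normrN gtr0_norm// mulr_natl mulr2n lerD.
have nR0 : 0 < n%:R :> R by rewrite ltr0n.
(* With at least [q] subdivisions, the first [n] steps cover a length of at most [eta * s], so these
   nodes stay in the cone. *)
pose q := 2 * rho * n%:R / (eta * s).
have es0 : 0 < eta * s by rewrite mulr_gt0.
have q0 : 0 <= q by rewrite divr_ge0 ?mulr_ge0// ltW.
pose m := (Num.truncn q).+1.
have mq : q <= m%:R by apply/ltW/truncnS_gt.
have mq1 : m%:R <= q + 1.
  by rewrite /m -natr1 lerD2r; have := truncn_le q; rewrite q0.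
have m0 : 0 < m%:R :> R by rewrite ltr0n.
have nq : n%:R <= q by rewrite ler_pdivlMr// mulrC; apply: ler_wpM2r; nra.
have nm : (0 < n <= m)%N.
  by rewrite n0 /= -(ler_nat R) (le_trans nq).
have mn : m%:R / n%:R <= expR (2 / eta * (1 + 2 * rho / K)).
  apply: le_trans (expR_ge1Dx _).
  rewrite ler_pdivrMr// (le_trans mq1)//.
  have -> : q = 2 / eta * (rho / s) * n%:R by rewrite /q; field; rewrite !gt_eqF.
  rewrite [leRHS]mulrDl mul1r [leRHS]addrC; apply: lerD; last by rewrite ler1n.
  apply: ler_wpM2r; first exact: ltW.
  by apply: ler_wpM2l => //; rewrite divr_ge0// ltW.
have node j : (j <= n)%N -> exists xhat,
    cap_times_interval x0 delta K (xhat, norm3 (segment3 p xi (j%:R / m%:R))) /\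
    scale3 (norm3 (segment3 p xi (j%:R / m%:R))) xhat = segment3 p xi (j%:R / m%:R).
  move=> jn; apply: (@near_axis_in_cap _ _ _ _ _ s eta) => //.
  rewrite (_ : sub3 _ _ = scale3 (j%:R / m%:R) (sub3 xi p)); last first.
    by apply: pt3_eq; rewrite /segment3 /p /=; ring.
  rewrite norm3_scale ger0_norm ?divr_ge0//.
  apply: (@le_trans _ _ (n%:R / m%:R * (2 * rho))).
    by apply: ler_pM => //; rewrite ?divr_ge0 ?norm3_ge0// ler_pM2r ?invr_gt0// ler_nat.
  rewrite mulrAC ler_pdivrMr//; move: mq; rewrite /q ler_pdivrMr//.
  by rewrite [n%:R * _]mulrC [m%:R * _]mulrC.
have eps0 := farfield_sup_ge0.
have fin (v : R) : v <= eps * ((m%:R / n%:R) ^+ n * expR (2 * n%:R)) +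
     M * expR (4 * (2 * rho * Rad) - n%:R) -> v <= B.
  move=> hv; apply: (le_trans hv); rewrite /B; apply: lerD; last first.
    by rewrite (_ : 4 * (2 * rho * Rad) = 8 * rho * Rad)//; ring.
  apply: ler_wpM2l => //.
  move: mn; set Z := 2 / eta * _ => mn.
  have -> : expR (n%:R * (2 + Z)) = expR Z ^+ n * expR (2 * n%:R).
    by rewrite -expRM_natl -expRD; congr expR; ring.
  apply: ler_wpM2r; first exact: expR_ge0.
  by apply: lerXn2r => //; rewrite nnegrE ?expR_ge0// divr_ge0.
have R2 : 0 <= 2 * rho by rewrite mulr_ge0// ltW.
split; apply: fin.
- apply: (ftRe_extrapolation ifr ifi hsupp hM hRad hM0 R2 eps0 hD nm) => j /node[xh [hc <-]].
  exact: (cap_le hc).1.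
- rewrite ftImE; apply: (ftRe_extrapolation ifi ifrN _ hMN hRad hM0 R2 eps0 hD nm).
    by move=> y /hsupp[-> ->]; rewrite oppr0.
  move=> j /node[xh [hc <-]]; rewrite -ftImE; exact: (cap_le hc).2.
Qed.

Lemma ft_eq0 xi : eps = 0 -> ftRe fr fi xi = 0 /\ ftIm fr fi xi = 0.
Proof.
move=> e0; pose rho := norm3 xi + 1.
have rho0 : 0 < rho by rewrite ltr_wpDl ?norm3_ge0.
have hxi : norm3 xi <= rho by rewrite lerDl.
have key (v : R) : (forall n, (0 < n)%N -> `|v| <= M * expR (8 * rho * Rad - n%:R)) -> v = 0.
  move=> hv; apply/eqP; rewrite -normr_le0; apply/ler_addgt0Pr => e e_gt0; rewrite add0r.
  pose c := M * expR (8 * rho * Rad).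
  have c0 : 0 <= c by rewrite mulr_ge0 ?expR_ge0.
  pose n := (Num.truncn (c / e)).+1.
  apply: (le_trans (hv n _)) => //.
  rewrite expRD mulrA -/c expRN ler_pdivrMr ?expR_gt0//.
  rewrite mulrC -ler_pdivrMr//.
  apply: (le_trans (ltW (truncnS_gt _))); apply: le_trans (expR_ge1Dx _).
  by rewrite lerDr.
by split; apply: key => n n0; have [] := ft_low_frequency rho0 n0 hxi;
  rewrite e0 mul0r add0r.
Qed.
End low_frequencies.

(** * Splitting the negative Sobolev norm, and an elementary inequality of Young type *)

Section final_estimates.
Variable R : realType.
Let mu3 := @leb3 R.

(** Inside the ball the weight is at most 1 and the volume at most that of the enclosing cube.
    Outside, the weight is at most [rho ^ -2] and [ft_L2_le] applies. The factor [(2 * pi) ^ -3] is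
    bounded by 1. *)
Lemma Hm1_norm2_le (fr fi : pt3 R -> R) (rho Q : R) :
  mu3.-integrable setT (EFin \o fr) -> mu3.-integrable setT (EFin \o fi) ->
  0 < rho -> 0 <= Q ->
  (forall xi, norm3 xi <= rho -> ftRe fr fi xi ^+ 2 + ftIm fr fi xi ^+ 2 <= Q) ->
  (Hm1_norm2 fr fi <=
   (Q * (2 * rho) ^+ 3)%:E + (rho ^- 2 * (2 * (8 * pi) ^+ 3))%:E * L2_norm2 fr fi)%E.
Proof.
move=> ifr ifi rho0 Q0 hQ.
pose P xi := ftRe fr fi xi ^+ 2 + ftIm fr fi xi ^+ 2.
have P0 xi : 0 <= P xi by rewrite addr_ge0 ?sqr_ge0.
have mP : measurable_fun setT P := measurable_ft_abs2 ifr ifi.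
have r2 : 0 < rho ^+ 2 by rewrite exprn_gt0.
have r2V : 0 <= rho ^- 2 by rewrite invr_ge0 ltW.
have w0 (xi : pt3 R) : 0 < 1 + dot3 xi xi by rewrite ltr_pwDl ?dot3_ge0.
have pi3 : (2 * pi) ^- 3 <= 1 :> R.
  by rewrite invf_le1 ?exprn_gt0 ?mulr_gt0 ?pi_gt0//; apply: exprn_ege1; have := @pi_ge2 R; lra.
have mw : measurable_fun setT (fun xi : pt3 R => (1 + dot3 xi xi)^-1).
  apply: (measurable_comp (F := [set t : R | 0 < t])) => //.
  - by rewrite -set_itvoy.
  - by move=> _ [xi _ <-] /=.
  - apply: open_continuous_measurable_fun; first by rewrite -set_itvoy; exact: interval_open.
    by move=> t; rewrite inE => /= t0; apply: cvgV; [rewrite gt_eqF|exact: cvg_id].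
  - apply: measurable_funD => //.
    apply: (@measurableT_comp _ _ _ _ _ _ (fun z : pt3 R * pt3 R => dot3 z.1 z.2) _
      (fun xi : pt3 R => (xi, xi))); first exact: measurable_dot3.
    exact: measurable_fun_pair.
apply: (@le_trans _ _ (\int[mu3]_xi (Q%:E * (box_indic rho xi)%:E + (rho ^- 2)%:E * (P xi)%:E))%E).
  apply: ge0_le_integral => //.
  - move=> xi _; rewrite lee_fin mulr_ge0 ?invr_ge0 ?(ltW (w0 xi))// mulr_ge0 ?P0//.
    by rewrite invr_ge0 exprn_ge0// mulr_ge0// pi_ge0.
  - by apply/measurable_EFinP; apply: measurable_funM => //; exact: measurable_funM.
  - apply: emeasurable_funD; apply: emeasurable_funM => //; apply/measurable_EFinP => //.
    exact: measurable_box_indic.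
  - move=> xi _; rewrite -!EFinM -EFinD lee_fin.
    have h : (1 + dot3 xi xi)^-1 * fhat_abs2 fr fi xi <= (1 + dot3 xi xi)^-1 * P xi.
      apply: ler_wpM2l; first by rewrite invr_ge0 ltW.
      by rewrite /fhat_abs2 ler_piMl// P0.
    apply: (le_trans h); have [hxi|hxi] := leP (norm3 xi) rho.
      rewrite (box_indic_eq1 hxi) mulr1; apply: ler_wpDr; first exact: mulr_ge0.
      apply: le_trans (hQ _ hxi); rewrite ler_piMl ?P0// invf_le1// lerDl; exact: dot3_ge0.
    apply: ler_wpDl; first by rewrite mulr_ge0 ?box_indic_ge0.
    apply: ler_wpM2r => //; rewrite lef_pV2 ?posrE// -norm3_sqr.
    by apply: ler_wpDl => //; apply: lerXn2r; rewrite ?nnegrE ?norm3_ge0 ?ltW.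
rewrite ge0_integralD//; last 4 first.
- by move=> xi _; rewrite -EFinM lee_fin mulr_ge0 ?box_indic_ge0.
- by apply: emeasurable_funM => //; apply/measurable_EFinP; exact: measurable_box_indic.
- by move=> xi _; rewrite -EFinM lee_fin mulr_ge0.
- by apply: emeasurable_funM => //; apply/measurable_EFinP.
have -> : (\int[mu3]_xi (Q%:E * (box_indic rho xi)%:E) = Q%:E * \int[mu3]_xi (box_indic rho xi)%:E)%E.
  rewrite ge0_integralZl//.
  - by apply/measurable_EFinP; exact: measurable_box_indic.
  - by move=> y _; rewrite lee_fin box_indic_ge0.
have -> : (\int[mu3]_xi ((rho ^- 2)%:E * (P xi)%:E) = (rho ^- 2)%:E * \int[mu3]_xi (P xi)%:E)%E.
  rewrite ge0_integralZl//; first exact/measurable_EFinP.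
  by move=> y _; rewrite lee_fin.
rewrite integral_box_indic// -EFinM; apply: leeD => //.
rewrite [(rho ^- 2 * (2 * _))%:E]EFinM -muleA; apply: lee_wpmul2l; first by rewrite lee_fin.
exact: ft_L2_le.
Qed.

(** Counting [a] with weight [1 / 3] and [b] with weight [1 / 4], the three monomials have weights
    [11 / 12], [5 / 6] and [1 / 4], all below the weight 1 of [a ^ 3] and [b ^ 4]. *)
Lemma mixed_monomials_le (c : R) : 1 <= c -> exists C : R, forall a b : R, 1 <= a -> 0 <= b ->
  c * (a ^+ 2 * b + a * b ^+ 2 + b) <= a ^+ 3 + b ^+ 4 + C.
Proof.
move=> c1; exists ((21 * c ^+ 3) ^+ 4 + c ^+ 3) => a b a1 b0.
have c0 : 0 <= c by lra.
have a0 : 0 <= a by lra.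
(* If [a] dominates, each monomial is at most a quarter of [a ^ 3]. Otherwise all are bounded by
   multiples [16 + 4 + 1 = 21] of [c ^ 3 * b ^ 3], up to a constant, and this is lower order than
   [b ^ 4]. *)
have [h|h] := leP (4 * c * b) a.
  have e1 : c * (a ^+ 2 * b) <= a ^+ 3 / 4.
    have : a ^+ 2 * (4 * c * b) <= a ^+ 2 * a by apply: ler_wpM2l => //; exact: sqr_ge0.
    lra.
  have hb : b <= a by nra.
  have e2 : c * (a * b ^+ 2) <= a ^+ 3 / 4.
    have h1 : a * b * (4 * c * b) <= a * b * a by apply: ler_wpM2l => //; exact: mulr_ge0.
    have h2 : a * a * b <= a * a * a by apply: ler_wpM2l => //; exact: mulr_ge0.
    lra.
  have e3 : c * b <= a ^+ 3 / 4.
    have : a * 1 <= a * (a * a) by apply: ler_wpM2l => //; nra.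
    lra.
  have e4 : 0 <= b ^+ 4 by exact: exprn_ge0.
  have e5 : 0 <= a ^+ 3 by exact: exprn_ge0.
  have e6 : 0 <= (21 * c ^+ 3) ^+ 4 + c ^+ 3.
    by rewrite addr_ge0 ?exprn_ge0// mulr_ge0// exprn_ge0.
  lra.
have c2 : c * 1 <= c * c by apply: ler_wpM2l.
have c3 : c ^+ 2 <= c ^+ 3 by apply: ler_weXn2l.
have b3 : 0 <= b ^+ 3 by exact: exprn_ge0.
have c30 : 0 <= c ^+ 3 by exact: exprn_ge0.
have cb : 0 <= 4 * c * b by rewrite !mulr_ge0.
have e1 : c * (a ^+ 2 * b) <= 16 * (c ^+ 3 * b ^+ 3).
  have : a ^+ 2 <= (4 * c * b) ^+ 2 by apply: lerXn2r; rewrite ?nnegrE// ltW.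
  move/(ler_wpM2l (mulr_ge0 c0 b0)); lra.
have e2 : c * (a * b ^+ 2) <= 4 * (c ^+ 3 * b ^+ 3).
  have := ler_wpM2l (mulr_ge0 c0 (sqr_ge0 b)) (ltW h).
  have := ler_wpM2r b3 c3; lra.
have e3 : c * b <= c ^+ 3 * b ^+ 3 + c ^+ 3.
  have h1 : c <= c ^+ 3 by lra.
  have h2 : b <= b ^+ 3 + 1.
    have [hb|hb] := leP b 1; first by lra.
    have : b ^+ 1 <= b ^+ 3 by apply: ler_weXn2l => //; exact: ltW.
    lra.
  have := ler_wpM2r b0 h1; have := ler_wpM2l c30 h2; lra.
have e4 : 21 * c ^+ 3 * b ^+ 3 <= b ^+ 4 + (21 * c ^+ 3) ^+ 4.
  set T := 21 * c ^+ 3; have T0 : 0 <= T by rewrite mulr_ge0.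
  have [hT|hT] := leP T b.
    have := ler_wpM2r b3 hT; have := exprn_ge0 4 T0; lra.
  have : b ^+ 3 <= T ^+ 3 by apply: lerXn2r; rewrite ?nnegrE// ltW.
  move/(ler_wpM2l T0); have := exprn_ge0 4 b0; lra.
have a30 : 0 <= a ^+ 3 by exact: exprn_ge0.
lra.
Qed.
End final_estimates.

(** * Balancing extrapolation growth against the data at the cutoff radius *)

Section frequency_cutoff.
Variable R : realType.

(* With [a = K^(1/3)], [b = |ln eps|^(1/4)] and cutoff radius [a^2 b], the
   growth of the extrapolation is absorbed by [expR K] and half of the decay of
   [eps ^+ 2]. *)
Lemma extrapolation_growth_le (eta Rad : R) : 0 < eta -> 1 <= Rad ->
  exists C : R, 0 < C /\ forall a b nu eps : R, 1 <= a -> 0 <= b -> 0 <= nu ->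
  nu <= 16 * (a ^+ 2 * b) * Rad + 1 -> eps = expR (- b ^+ 4) ->
  (a ^+ 2 * b) ^+ 3 * (eps * expR (nu * (2 + 2 / eta * (1 + 2 * (a ^+ 2 * b) / a ^+ 3)))) ^+ 2
  <= C * (expR (a ^+ 3) * eps).
Proof.
move=> eta0 Rad1.
pose c1 := 2 + 2 / eta; pose c2 := 4 / eta.
have c10 : 0 <= c1 by rewrite addr_ge0// divr_ge0// ltW.
have c20 : 0 <= c2 by rewrite divr_ge0// ltW.
(* One constant dominating the coefficients of [a ^ 2 * b], [a * b ^ 2] and [b] in the final
   exponent. Squaring doubles [16 * Rad] to [32 * Rad], and the factor [rho ^ 3], at most
   [expR (3 * rho)], adds 3. *)
pose c := 32 * Rad * (c1 + c2) + 2 * c2 + 4.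
have R0 : 0 <= Rad by lra.
have Rc : 0 <= Rad * (c1 + c2) by apply: mulr_ge0 => //; exact: addr_ge0.
have c1' : 1 <= c by rewrite /c; lra.
have [CC hCC] := mixed_monomials_le c1'.
exists (expR (CC + 2 * c1)); split; first exact: expR_gt0.
move=> a b nu eps a1 b0 nu0 hnu ->.
have a0 : 0 < a by lra.
set rho := a ^+ 2 * b.
have rho0 : 0 <= rho by rewrite mulr_ge0// sqr_ge0.
have rhoK : rho / a ^+ 3 = b / a by rewrite /rho; field; rewrite gt_eqF.
have -> : 2 + 2 / eta * (1 + 2 * rho / a ^+ 3) = c1 + c2 * (b / a).
  by rewrite -[2 * rho / _]mulrA rhoK /c1 /c2; field; rewrite !gt_eqF.
have ba0 : 0 <= b / a by rewrite divr_ge0// ltW.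
have ba : b / a <= b by rewrite ler_pdivrMr// ler_peMr.
have d0 : 0 <= c1 + c2 * (b / a) by rewrite addr_ge0// mulr_ge0.
have h1 : nu * (c1 + c2 * (b / a)) <= (16 * rho * Rad + 1) * (c1 + c2 * (b / a)).
  by apply: ler_wpM2r.
have h2 : (16 * rho * Rad + 1) * (c1 + c2 * (b / a)) =
    16 * Rad * c1 * rho + 16 * Rad * c2 * (a * b ^+ 2) + c1 + c2 * (b / a).
  by rewrite /rho; field; rewrite gt_eqF.
have h3 := hCC a b a1 b0.
have ab0 : 0 <= a * b ^+ 2 by rewrite mulr_ge0 ?sqr_ge0// ltW.
have h4 : c2 * (b / a) <= c2 * b by apply: ler_wpM2l.
have t1 : 32 * Rad * c1 * rho + 3 * rho <= c * rho.
  have -> : c * rho = 32 * Rad * c1 * rho + 32 * (Rad * c2 * rho) + 2 * (c2 * rho) + 4 * rho.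
    by rewrite /c; ring.
  have : 0 <= Rad * c2 * rho by apply: mulr_ge0 => //; exact: mulr_ge0.
  have : 0 <= c2 * rho by exact: mulr_ge0.
  lra.
have t2 : 32 * Rad * c2 * (a * b ^+ 2) <= c * (a * b ^+ 2).
  have e : 0 <= Rad * c1 by rewrite mulr_ge0.
  by apply: ler_wpM2r => //; rewrite /c; lra.
have t3 : 2 * c2 * b <= c * b by apply: ler_wpM2r => //; rewrite /c; lra.
have h5 : 3 * rho + nu * (c1 + c2 * (b / a)) * 2 <= a ^+ 3 + b ^+ 4 + CC + 2 * c1.
  move: h3; rewrite -/rho mulrDr mulrDr => h3; lra.
have h6 : rho ^+ 3 <= expR (3 * rho).
  rewrite expRM_natl; apply: lerXn2r; rewrite ?nnegrE ?expR_ge0//.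
  by apply: le_trans (expR_ge1Dx _); lra.
apply: (le_trans (ler_wpM2r _ h6)); first exact: sqr_ge0.
rewrite exprMn expr2 -[expR _ ^+ 2]expRM_natr -!expRD ler_expR; lra.
Qed.

(** Clearing denominators leaves [rho ^ 5] against [expR (16 * rho)], which follows from
    [rho <= expR rho]. *)
Lemma exp_decay_le (rho : R) : 0 < rho -> rho ^+ 3 * expR (- (8 * rho)) ^+ 2 <= rho ^- 2.
Proof.
move=> rho0; rewrite -[leRHS]mul1r ler_pdivlMr ?exprn_gt0// mulrAC -exprD /=.
rewrite -expRM_natr mulNr expRN ler_pdivrMr ?expR_gt0// mul1r.
apply: (@le_trans _ _ (expR (5 * rho))); last by rewrite ler_expR; lra.
rewrite expRM_natl; apply: lerXn2r; rewrite ?nnegrE ?expR_ge0 ?ltW//.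
by apply: lt_le_trans (expR_ge1Dx _); lra.
Qed.

Lemma powR_root (x : R) (n : nat) : 0 <= x -> (0 < n)%N -> (x `^ (1 / n%:R)) ^+ n = x.
Proof.
move=> x0 n0; rewrite -powR_mulrn ?powR_ge0// -powRrM divfK ?powRr1//.
by rewrite pnatr_eq0 -lt0n.
Qed.
End frequency_cutoff.

(** * The stability estimate from both frequency ranges *)

Theorem theorem2 (R : realType) (Rad delta : R) (hRad : 1 <= Rad) (hdelta : 0 < delta) :
  exists alpha : R, (0 < alpha < 1) /\
  forall x0 : pt3 R, norm3 x0 = 1 ->
  exists C : R, 0 < C /\
  forall (K : R) (fr fi : pt3 R -> R),
    1 < K ->
    measurable_fun setT fr -> measurable_fun setT fi ->
    (L2_norm2 fr fi < +oo)%E ->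
    (forall y, Rad <= norm3 y -> fr y = 0 /\ fi y = 0) ->
    let M0 := Num.sqrt (fine (L2_norm2 fr fi)) in
    let eps := farfield_sup fr fi x0 delta K in
    eps < 1 ->
    (Hm1_norm2 fr fi <=
      (C * (K ^+ 3 * expR (2 * K * (1 - alpha)) * eps `^ (2 * alpha)
            + M0 ^+ 2 / (K `^ (4 / 3) * `|ln eps| `^ (1 / 2))))%:E)%E.
Proof.
have Rad0 : 0 < Rad by lra.
exists (1 / 2); split; first by apply/andP; split; lra.
move=> x0 hx0.
have eta0 := aperture_gt0 hdelta.
(* [C1] depends only on the aperture and [Rad]; it is fixed before [K] and the source are
   introduced. *)
have [C1 [C1_gt0 hC1]] := extrapolation_growth_le eta0 hRad.
pose c0 := (2 * Rad) ^+ 3 + 1.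
have c00 : 0 <= c0 by rewrite addr_ge0// exprn_ge0// mulr_ge0// ltW.
have pi3 : 0 <= 2 * (8 * pi) ^+ 3 :> R by rewrite mulr_ge0// exprn_ge0// mulr_ge0// pi_ge0.
(* The factor 32 is 4, from squaring [G + H] for two components, times the 8 of a cube of side
   [2 * rho]. The last summand comes from the high frequencies. *)
exists (32 * C1 + 32 * c0 ^+ 2 + 2 * (8 * pi) ^+ 3); split.
  by apply: ltr_pwDl => //; apply: ltr_pwDl; [rewrite mulr_gt0|rewrite mulr_ge0 ?sqr_ge0].
move=> K fr fi K1 mfr mfi hL2 hsupp M0 eps eps1.
have K0 : 0 < K by lra.
have [ifr ifi] := integrable_source Rad0 mfr mfi hL2 hsupp.
have hM := L1_le_L2 Rad0 mfr mfi hL2 hsupp.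
have M00 : 0 <= M0 by exact: sqrtr_ge0.
rewrite -/c0 -[L2n fr fi]/M0 in hM.
have cM0 : 0 <= c0 * M0 by exact: mulr_ge0.
have eps0 : 0 <= eps := farfield_sup_ge0 hdelta K0 hx0 cM0 ifr ifi hM.
have alpha1 : 2 * (1 / 2) = 1 :> R by field.
have alpha2 : 2 * K * (1 - 1 / 2) = K by field.
rewrite alpha1 alpha2 powRr1//.
have C0 : 0 <= 32 * C1 + 32 * c0 ^+ 2 + 2 * (8 * pi) ^+ 3.
  by apply: addr_ge0 => //; apply: addr_ge0; apply: mulr_ge0 => //; [exact: ltW|exact: sqr_ge0].
have [eps_eq0|eps_neq0] := eqVneq eps 0.
  have -> : Hm1_norm2 fr fi = 0%E.
    rewrite /Hm1_norm2; apply: integral0_eq => xi _.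
    have [h1 h2] := ft_eq0 (ltW Rad0) hdelta K0 hx0 cM0 ifr ifi hsupp hM xi eps_eq0.
    by rewrite /fhat_abs2 h1 h2 expr0n /= addr0 !mulr0.
  rewrite lee_fin mulr_ge0// addr_ge0//.
    by rewrite mulr_ge0// mulr_ge0 ?expR_ge0// exprn_ge0// ltW.
  by rewrite divr_ge0 ?sqr_ge0// mulr_ge0 ?powR_ge0.
have eps_gt0 : 0 < eps by rewrite lt_neqAle eq_sym eps_neq0.
pose L := - ln eps.
have L0 : 0 < L by rewrite oppr_gt0 ln_lt0// eps_gt0.
have -> : `|ln eps| = L by rewrite ltr0_norm// -oppr_gt0.
pose a := K `^ (1 / 3); pose b := L `^ (1 / 4); pose rho := a ^+ 2 * b.
have a3 : a ^+ 3 = K by rewrite /a powR_root// ltW.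
have b4 : b ^+ 4 = L by rewrite /b powR_root// ltW.
have a1 : 1 <= a by rewrite -(powRr0 K) ler_powR ?divr_ge0// ltW.
have b_gt0 : 0 < b by exact: powR_gt0.
have rho0 : 0 < rho by rewrite mulr_gt0// exprn_gt0//; lra.
(* The denominator of the statement is exactly the square of the cutoff radius, so the
   high-frequency term has the required form. *)
have rho2 : K `^ (4 / 3) * L `^ (1 / 2) = rho ^+ 2.
  have -> : K `^ (4 / 3) = K `^ (1 / 3 * 4%:R) by congr powR; field.
  have -> : L `^ (1 / 2) = L `^ (1 / 4 * 2%:R) by congr powR; field.
  by rewrite (powRrM K) (powRrM L) !powR_mulrn ?powR_ge0// -/a -/b /rho exprMn -exprM.
have epsE : eps = expR (- b ^+ 4) by rewrite b4 opprK lnK.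
(* This makes [8 * rho * Rad - n] at most [- 8 * rho * Rad], hence at most [- 8 * rho] because
   [Rad >= 1]. *)
pose n := (Num.truncn (16 * rho * Rad)).+1.
have q0 : 0 <= 16 * rho * Rad by apply: mulr_ge0 (ltW Rad0); apply: mulr_ge0 (ltW rho0).
have n1 : 16 * rho * Rad <= n%:R by apply/ltW/truncnS_gt.
have n2 : n%:R <= 16 * rho * Rad + 1.
  by rewrite /n -natr1 lerD2r; have := truncn_le (16 * rho * Rad); rewrite q0.
have growth := hC1 a b n%:R eps a1 (ltW b_gt0) (ler0n _ _) n2 epsE.
rewrite -/rho a3 in growth.
set G := eps * expR _ in growth.
pose H := c0 * M0 * expR (- (8 * rho)).
have H0 : 0 <= H by rewrite mulr_ge0 ?expR_ge0.
have low xi : norm3 xi <= rho ->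
    ftRe fr fi xi ^+ 2 + ftIm fr fi xi ^+ 2 <= 4 * (G ^+ 2 + H ^+ 2).
  move=> hxi.
  have [] := ft_low_frequency (ltW Rad0) hdelta K0 hx0 cM0 ifr ifi hsupp hM rho0 (ltn0Sn _ : 0 < n)%N hxi.
  rewrite -/eps -/G.
  have hH : c0 * M0 * expR (8 * rho * Rad - n%:R) <= H.
    apply: ler_wpM2l => //; rewrite ler_expR.
    have : rho * 1 <= rho * Rad by rewrite ler_pM2l.
    lra.
  move=> h1 h2.
  have k1 : `|ftRe fr fi xi| <= G + H by lra.
  have k2 : `|ftIm fr fi xi| <= G + H by lra.
  rewrite -[ftRe _ _ _ ^+ 2]real_normK ?num_real// -[ftIm _ _ _ ^+ 2]real_normK ?num_real//.
  have GH : 0 <= G + H by exact: le_trans k1.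
  have e1 : `|ftRe fr fi xi| ^+ 2 <= (G + H) ^+ 2 by apply: lerXn2r; rewrite ?nnegrE.
  have e2 : `|ftIm fr fi xi| ^+ 2 <= (G + H) ^+ 2 by apply: lerXn2r; rewrite ?nnegrE.
  have := sqr_ge0 (G - H); nra.
have Q0 : 0 <= 4 * (G ^+ 2 + H ^+ 2) by rewrite mulr_ge0// addr_ge0 ?sqr_ge0.
apply: (le_trans (Hm1_norm2_le ifr ifi rho0 Q0 low)).
have -> : L2_norm2 fr fi = (M0 ^+ 2)%:E by rewrite -L2n_sqr.
rewrite -EFinM -EFinD lee_fin rho2.
have decay := exp_decay_le rho0.
(* The growth bound carries no power of [K]; the factor [K ^ 3], at least 1, is inserted here. *)
have K3 : expR K * eps <= K ^+ 3 * expR K * eps.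
  rewrite -mulrA; apply: ler_peMl; first by rewrite mulr_ge0 ?expR_ge0.
  by apply: exprn_ege1; exact: ltW.
set A := K ^+ 3 * expR K * eps in K3 *; set r := rho ^- 2 in decay *.
have A0 : 0 <= A by apply: le_trans K3; rewrite mulr_ge0 ?expR_ge0.
have r0 : 0 <= r by rewrite invr_ge0 exprn_ge0// ltW.
have M2 : 0 <= M0 ^+ 2 by exact: sqr_ge0.
have c2 : 0 <= c0 ^+ 2 by exact: sqr_ge0.
have f1 : rho ^+ 3 * G ^+ 2 <= C1 * A.
  by apply: (le_trans growth); apply: ler_wpM2l => //; exact: ltW.
have f2 : rho ^+ 3 * H ^+ 2 <= c0 ^+ 2 * M0 ^+ 2 * r.
  have -> : rho ^+ 3 * H ^+ 2 = c0 ^+ 2 * M0 ^+ 2 * (rho ^+ 3 * expR (- (8 * rho)) ^+ 2).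
    by rewrite /H; ring.
  by apply: ler_wpM2l => //; exact: mulr_ge0.
have g1 : 0 <= c0 ^+ 2 * A by exact: mulr_ge0.
have g2 : 0 <= 2 * (8 * pi) ^+ 3 * A by exact: mulr_ge0.
have g3 : 0 <= C1 * (M0 ^+ 2 * r) by rewrite mulr_ge0 ?(ltW C1_gt0)// mulr_ge0.
have -> : 4 * (G ^+ 2 + H ^+ 2) * (2 * rho) ^+ 3 =
    32 * (rho ^+ 3 * G ^+ 2) + 32 * (rho ^+ 3 * H ^+ 2) by ring.
(* The first three terms dominate the left-hand side; the bracket collects the nonnegative cross
   terms. *)
have -> : (32 * C1 + 32 * c0 ^+ 2 + 2 * (8 * pi) ^+ 3) * (A + M0 ^+ 2 * r) =
    32 * (C1 * A) + 32 * (c0 ^+ 2 * M0 ^+ 2 * r) + r * (2 * (8 * pi) ^+ 3) * M0 ^+ 2 +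
    (32 * (c0 ^+ 2 * A) + 2 * (8 * pi) ^+ 3 * A + 32 * (C1 * (M0 ^+ 2 * r))) by ring.
set p3 := r * (2 * _) * _; set p4 := 2 * _ * A in g2 *; lra.
Qed.
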